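(* Let $L\subset H=M\times\mathbb{H}^2$ be a Willmore surface in $\mathbb{H}P^1$ with Hopf field $A\not\equiv0$ on each component of $M$. Let $\tilde L\subset H$ be its 2-step Bäcklund transform, i.e. the unique quaternionic line subbundle with $\tilde L=\ker A$ on an open dense subset of $M$, and assume that $\tilde L$ is immersed. Let $\tilde Q$ denote the Hopf field $Q$ associated with $\tilde L$. Then $$\tilde Q=A .$$ Hence $\tilde L$ is again a Willmore surface.
   Context: $\mathbb{H}$ denotes the quaternions; quaternionic vector spaces are right vector spaces. $M$ is a Riemann surface with complex structure $J$ on $TM$, and $*\omega(X)=\omega(JX)$ for 1-forms $\omega$. For a quaternionic line subbundle $L\subset H=M\times\mathbb{H}^2$ (equivalently a map $M\to\mathbb{H}P^1$) let $\pi:H\to H/L$ be the projection and $\delta\in\Omega^1(\mathrm{Hom}(L,H/L))$, $\delta(X)\psi=\pi(d\psi(X))$ for $\psi\in\Gamma(L)$. $L$ is immersed if $\delta_p$ is injective on $T_pM$ for all $p$; $L$ is a holomorphic curve if there is $J_L\in\Gamma(\mathrm{End}(L))$ with $J_L^2=-I$ and $*\delta=\delta J_L$. Mean curvature sphere: for an immersed holomorphic curve $L$ there is a unique $S\in\Gamma(\mathrm{End}(H))$ with $S^2=-I$, $SL=L$, $(dS)L\subset L$, $*\delta=\delta\circ S=S\circ\delta$ (with $S$ also denoting the induced endomorphism of $H/L$) and $Q|_L=0$, where $Q:=\frac14(SdS-*dS)$. The Hopf fields are $Q$ and $A:=\frac14(SdS+*dS)$. The kernel of $A(X)$ at a point does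 not depend on the choice of $X\ne0$ and is denoted $\ker A$. Willmore surface: an immersed holomorphic curve $L$ with $d*A=0$ (equivalently $d*Q=0$). For compact $M$ this is equivalent to being a critical point of $W(L)=\frac1\pi\int_M\frac18\mathrm{trace}_{\mathbb{R}}(A\wedge *A)$ under variations of the immersion. For a Willmore surface with $A\not\equiv0$ on each component, the line subbundle $\tilde L$ with $\tilde L=\ker A$ on an open dense set exists and is unique; if immersed, it is a holomorphic curve with respect to the given complex structure of $M$, so that its mean curvature sphere $\tilde S$ and $\tilde Q=\frac14(\tilde Sd\tilde S-*d\tilde S)$ are defined. *)

(* Defs.v *)
From HB Require Import structures.
From mathcomp Require Import all_boot all_order all_algebra ring.
From mathcomp Require Import boolp classical_sets functions reals.
From mathcomp Require Import topology normedtype derive.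

Set Implicit Arguments.
Unset Strict Implicit.
Unset Printing Implicit Defensive.

Import Order.TTheory GRing.Theory Num.Theory.
Import numFieldNormedType.Exports.
Local Open Scope classical_set_scope.
Local Open Scope ring_scope.

(** [Quat a b c d] is a + b i + c j + d k. *)

Record quat (R : realType) := Quat { qr : R; qi : R; qj : R; qk : R }.

Section QuatRing.
Variable R : realType.
Implicit Types x y z : quat R.

Definition quat_to (x : quat R) : R * R * R * R := (qr x, qi x, qj x, qk x).
Definition quat_of (t : R * R * R * R) : quat R :=
  let: (a, b, c, d) := t in Quat a b c d.
Lemma quat_toK : cancel quat_to quat_of. Proof. by case. Qed.

HB.instance Definition _ := Choice.copy (quat R) (can_type quat_toK).

Definition addq x y :=
  Quat (qr x + qr y) (qi x + qi y) (qj x + qj y) (qk x + qk y).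
Definition oppq x := Quat (- qr x) (- qi x) (- qj x) (- qk x).
Definition mulq x y := Quat
  (qr x * qr y - qi x * qi y - qj x * qj y - qk x * qk y)
  (qr x * qi y + qi x * qr y + qj x * qk y - qk x * qj y)
  (qr x * qj y - qi x * qk y + qj x * qr y + qk x * qi y)
  (qr x * qk y + qi x * qj y - qj x * qi y + qk x * qr y).
Definition realq (a : R) : quat R := Quat a 0 0 0.

Fact addqA : associative addq.
Proof. by move=> x y z; rewrite /addq /= !addrA. Qed.
Fact addqC : commutative addq.
Proof. by move=> x y; congr Quat; rewrite addrC. Qed.
Fact add0q : left_id (realq 0) addq.
Proof. by case=> a b c d; rewrite /addq /= !add0r. Qed.
Fact addNq : left_inverse (realq 0) oppq addq.
Proof. by move=> x; rewrite /addq /= !addNr. Qed.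
HB.instance Definition _ :=
  GRing.isZmodule.Build (quat R) addqA addqC add0q addNq.

Fact mulqA : associative mulq.
Proof. by move=> x y z; congr Quat => /=; ring. Qed.
Fact mul1q : left_id (realq 1) mulq.
Proof. by case=> a b c d; congr Quat => /=; ring. Qed.
Fact mulq1 : right_id (realq 1) mulq.
Proof. by case=> a b c d; congr Quat => /=; ring. Qed.
Fact mulqDl : left_distributive mulq addq.
Proof. by move=> x y z; congr Quat => /=; ring. Qed.
Fact mulqDr : right_distributive mulq addq.
Proof. by move=> x y z; congr Quat => /=; ring. Qed.
Fact oneq_neq0 : realq 1 != realq 0.
Proof. by apply/eqP => -[] /eqP; rewrite oner_eq0. Qed.
HB.instance Definition _ := GRing.Zmodule_isNzRing.Build (quat R)
  mulqA mul1q mulq1 mulqDl mulqDr oneq_neq0.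

End QuatRing.

(** H^2 is ['cV[quat R]_2], a right vector space; right-linear endomorphisms
    are the matrices ['M[quat R]_2] acting on the left. *)
Definition rscale (R : realType) n (u : 'cV[quat R]_n) (a : quat R) :
  'cV[quat R]_n := u *m (a%:M : 'M_1).


(** Multiplication by i on the real plane, identified with C. *)
Definition rot (R : realType) (X : R * R) : R * R := (- X.2, X.1).

Record chart (R : realType) (M : topologicalType) := Chart {
  cdom : set M;
  cmap : M -> R * R;
  cinv : R * R -> M;
  cdom_open : open cdom;
  crange_open : open (cmap @` cdom);
  cmapK : forall p, cdom p -> cinv (cmap p) = p;
  cmap_continuous : {within cdom, continuous cmap};
  cinv_continuous : {within cmap @` cdom, continuous cinv} }.

(** The differential of a transition map being complex linear says both that
    the transition map is holomorphic and that the complex structure J of the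
    tangent bundle, which is [rot] in every chart, is well defined. *)
Definition holomorphic_atlas (R : realType) (M : topologicalType)
    (atlas : set (chart R M)) : Prop :=
  forall c1 c2, atlas c1 -> atlas c2 -> forall p, cdom c1 p -> cdom c2 p ->
    let tau : R * R -> R * R := cmap c2 \o cinv c1 in
    differentiable tau (cmap c1 p) /\
    forall X, 'd tau (cmap c1 p) (rot X) = rot ('d tau (cmap c1 p) X).

Record riemannSurface (R : realType) := RiemannSurface {
  rs_space :> topologicalType;
  atlas : set (chart R rs_space);
  rs_hausdorff : hausdorff_space rs_space;
  atlas_cover : forall p, exists2 c, atlas c & cdom c p;
  atlas_holomorphic : holomorphic_atlas atlas }.


(** All iterated directional derivatives exist and are differentiable, i.e.
    [g] is C^oo on the open set [D]. *)
Definition smooth_plane (R : realType) (D : set (R * R)) (g : R * R -> R) :=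
  forall (s : seq (R * R)) (x : R * R), D x ->
    differentiable (foldr (fun v h => fun y => 'D_v h y) g s : R * R -> R) x.

Section Calculus.
Variables (R : realType) (M : riemannSurface R).

Definition smoothR (V : set M) (f : M -> R) : Prop :=
  forall c, atlas c ->
    smooth_plane (cmap c @` (V `&` cdom c)) (f \o cinv c).

Definition smoothH (V : set M) (f : M -> quat R) : Prop :=
  [/\ smoothR V (@qr R \o f), smoothR V (@qi R \o f),
      smoothR V (@qj R \o f) & smoothR V (@qk R \o f)].

Definition smooth m n (V : set M) (F : M -> 'M[quat R]_(m, n)) : Prop :=
  forall i j, smoothH V (fun p => F p i j).

(** A tangent vector at [p] is given by a chart [c] around [p] and its
    coordinates [X : R * R] in this chart. *)
Definition dR (c : chart R M) (f : M -> R) (p : M) (X : R * R) : R :=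
  'D_X (f \o cinv c) (cmap c p).

Definition dH (c : chart R M) (f : M -> quat R) (p : M) (X : R * R) : quat R :=
  Quat (dR c (@qr R \o f) p X) (dR c (@qi R \o f) p X)
       (dR c (@qj R \o f) p X) (dR c (@qk R \o f) p X).

Definition dM m n (c : chart R M) (F : M -> 'M[quat R]_(m, n)) (p : M)
    (X : R * R) : 'M[quat R]_(m, n) :=
  \matrix_(i, j) dH c (fun q => F q i j) p X.

(** End(H)-valued 1-forms, H being the trivial bundle with fibre H^2. *)
Definition form1 := chart R M -> M -> R * R -> 'M[quat R]_2.

Definition eq_form1 (w1 w2 : form1) : Prop :=
  forall c p X, atlas c -> cdom c p -> w1 c p X = w2 c p X.

Definition star (w : form1) : form1 := fun c p X => w c p (rot X).

(** dw(X, Y) = X(w(Y)) - Y(w(X)) for the commuting coordinate fields X, Y. *)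
Definition d_form1 (w : form1) (c : chart R M) (p : M) (X Y : R * R) :
  'M[quat R]_2 :=
  dM c (fun q => w c q Y) p X - dM c (fun q => w c q X) p Y.

Definition closed_form1 (w : form1) : Prop :=
  forall c p X Y, atlas c -> cdom c p -> d_form1 w c p X Y = 0.


Definition is_line_subbundle (L : M -> set 'cV[quat R]_2) : Prop :=
  forall p, exists V : set M, exists psi : M -> 'cV[quat R]_2,
    [/\ open V, V p, smooth V psi &
        forall q, V q -> psi q != 0 /\ L q = range (rscale (psi q))].

Record lineSubbundle := LineSubbundle {
  fiber :> M -> set 'cV[quat R]_2;
  fiberP : is_line_subbundle fiber }.

Implicit Types (L : lineSubbundle) (S : M -> 'M[quat R]_2).

Definition local_section L (V : set M) (psi : M -> 'cV[quat R]_2) : Prop :=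
  [/\ open V, smooth V psi & forall q, V q -> L q (psi q)].

(** The projection H -> H/L; elements of (H/L)_p are cosets of L_p in H^2. *)
Definition proj L (p : M) (u : 'cV[quat R]_2) : set 'cV[quat R]_2 :=
  [set w | L p (w - u)].

(** delta(X) psi = proj (d psi (X)). *)
Definition delta L (c : chart R M) (p : M) (X : R * R)
    (psi : M -> 'cV[quat R]_2) : set 'cV[quat R]_2 :=
  proj L p (dM c psi p X).

Definition immersed L : Prop :=
  forall c p X, atlas c -> cdom c p ->
    (forall V psi, V p -> local_section L V psi ->
      delta L c p X psi = proj L p 0) ->
    X = 0.

(** A smooth section of End(L); the values of [J p] outside L_p are
    irrelevant. *)
Definition line_endo L (J : M -> 'cV[quat R]_2 -> 'cV[quat R]_2) : Prop :=
  [/\ forall p u, L p u -> L p (J p u),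
      forall p u v, L p u -> L p v -> J p (u + v) = J p u + J p v,
      forall p u a, L p u -> J p (rscale u a) = rscale (J p u) a &
      forall V psi, local_section L V psi -> smooth V (fun q => J q (psi q))].

Definition holomorphic_curve L : Prop :=
  exists J : M -> 'cV[quat R]_2 -> 'cV[quat R]_2,
    [/\ line_endo L J,
        forall p u, L p u -> J p (J p u) = - u &
        forall c p X V psi, atlas c -> cdom c p -> V p ->
          local_section L V psi ->
          delta L c p (rot X) psi = delta L c p X (fun q => J q (psi q))].


Definition quarter : quat R := realq 4^-1.

Definition hopfQ S : form1 := fun c p X =>
  quarter *: (S p *m dM c S p X - star (fun c => dM c S) c p X).

Definition hopfA S : form1 := fun c p X =>
  quarter *: (S p *m dM c S p X + star (fun c => dM c S) c p X).

Definition mean_curvature_sphere L S : Prop :=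
  smooth setT S /\
  (forall p, S p *m S p = - 1%:M) /\
  (forall p, mulmx (S p) @` L p = L p) /\
  (forall c p X u, atlas c -> cdom c p -> L p u -> L p (dM c S p X *m u)) /\
  (forall c p X V psi, atlas c -> cdom c p -> V p -> local_section L V psi ->
     delta L c p (rot X) psi = delta L c p X (fun q => S q *m psi q) /\
     delta L c p (rot X) psi = mulmx (S p) @` delta L c p X psi) /\
  (forall c p X u, atlas c -> cdom c p -> L p u -> hopfQ S c p X *m u = 0).

Definition willmore L : Prop :=
  [/\ immersed L, holomorphic_curve L &
      exists S, mean_curvature_sphere L S /\ closed_form1 (star (hopfA S))].

(** The common kernel of the A(X), which is the kernel of any A(X), X != 0. *)
Definition kerA S (p : M) : set 'cV[quat R]_2 :=
  [set u | forall c X, atlas c -> cdom c p -> hopfA S c p X *m u = 0].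

Definition hopfA_nonzero_on_components S : Prop :=
  forall p : M, exists q : M, connected_component setT p q /\
    exists c X, [/\ atlas c, cdom c q & hopfA S c q X <> 0].

(** [Lt] is the 2-step Baecklund transform of the Willmore surface with mean
    curvature sphere [S]. *)
Definition two_step_backlund S (Lt : lineSubbundle) : Prop :=
  exists U : set M, [/\ open U, dense U & forall p, U p -> Lt p = kerA S p].

End Calculus.

(* Main.v *)
From mathcomp Require Import all_boot all_order all_algebra ring lra.
From mathcomp Require Import boolp classical_sets functions reals.
From mathcomp Require Import topology normedtype landau derive.
Require Import Defs.

(** Write X for a coordinate field, Y = JX, and let indices 1 and 2 denote
    derivatives along X and Y.

    Near any point a line bundle is the graph of an affine coordinate g: it is
    spanned by a section psi ([gsec]) whose derivatives are multiples of a
    constant vector, and it is the kernel of a row vector rho ([gann]).  If it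
    is immersed, g_1 is invertible, and psi_2 = psi_1 mu with
    mu = g_1^-1 g_2.  In these terms the conditions on a mean curvature sphere
    T can be solved: necessarily
      T psi = psi mu,   T psi_1 = psi_1 mu + psi beta,
      beta = (mu_1 + mu mu_2) / 2   ([mcs_formula]).
    Hence T is unique and independent of charts and coordinates; conversely
    these formulas define a mean curvature sphere as soon as mu^2 = -1
    ([mcs_exists]).  Transition maps are given only as differentiable maps
    with complex linear differential, so smoothness cannot be carried from one
    chart to another; it comes from uniqueness, by which T is, near a point of
    any chart, the solution built in that chart.

    Let S be the sphere of the Willmore surface L and let psi span Lt.
    Differentiating A psi = 0 and using d*A = 0 gives
    A_1 psi_1 + A_2 psi_2 = 0.  As A_2 = S A_1 = - A_1 S, the vector
    psi_1 - S psi_2 lies in ker A = Lt, and Lt is S-stable, so that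
    psi_2 = - S psi_1 modulo Lt ([backlund_stable], [backlund_conf]).  This
    yields mu^2 = -1, so Lt has a mean curvature sphere St.  These arguments
    apply on the dense set where Lt = ker A, and the resulting identities
    extend by continuity.

    Where the lines L and Lt differ, L is spanned by w = psi_1 + psi z with
    S w = - w mu.  Substituting w into Q w = 0, and using the symmetry of the
    second derivatives of g, gives beta = z mu - mu z ([backlund_beta]).  That
    is, St w = w mu: the sphere St equals -S on L.  From this, Qt and A agree
    on w ([hopf_fields_agree]), while both vanish on psi.  The lines cannot
    coincide on an open set, where psi_2 would be both S psi_1 and - S psi_1
    modulo the line ([backlund_line_differs]); by continuity Qt = A
    everywhere.  Finally the Hopf field A of St is Qt plus half of the
    derivative of St along J, and the symmetry of second derivatives of St
    turns d*A = 0 into the Willmore equation of Lt. *)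

Set Implicit Arguments.
Unset Strict Implicit.
Unset Printing Implicit Defensive.

Import Order.TTheory GRing.Theory Num.Theory.
Import numFieldNormedType.Exports.
Local Open Scope classical_set_scope.
Local Open Scope ring_scope.

(** * Smooth functions on the plane and the symmetry of second derivatives *)

Lemma near_eq_differentiable (R : realType) (V W : normedModType R)
    (f g : V -> W) x : (\forall y \near x, f y = g y) ->
  differentiable f x -> differentiable g x.
Proof.
move=> fg df; have fgx : f x = g x := nbhs_singleton fg.
have gE : g \o shift x = cst (g x) + 'd f x +o_ 0 id.
  apply/eqaddoP => e e0.
  have /eqaddoP/(_ e e0) := diff_locally df.
  have fg0 : \forall w \near 0, f (w + x) = g (w + x).
    by move: fg; rewrite (near_shift 0); apply: filterS => w; rewrite /= subr0.
  apply: filterS2 fg0 => w fgw.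
  suff -> : (f \o shift x - (cst (f x) + 'd f x)) w =
            (g \o shift x - (cst (g x) + 'd f x)) w by [].
  by rewrite /GRing.add /GRing.opp /= fgw fgx.
have dgE : 'd g x = 'd f x :> (V -> W).
  by apply: diff_unique gE; exact: diff_continuous.
by apply/diff_locallyP; rewrite dgE; split=> //; exact: diff_continuous.
Qed.

Section Schwarz.
Variables (R : realType) (V : normedModType R).
Implicit Types (f : V -> R) (x u v : V).

(** The little-o expansion of a differentiable function in a form that can be
    combined with real inequalities. *)
Lemma differentiable_eps f x : differentiable f x ->
  forall e : R, 0 < e -> exists2 d : R, 0 < d &
    forall w, `|w| < d -> `|f (x + w) - f x - 'd f x w| <= e * `|w|.
Proof.
move=> /diff_locally/eqaddoP fE e e0.
have := fE e e0 => /nbhs_ballP[d /= d0 dP].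
exists d => // w wd.
have := dP w; rewrite -ball_normE /= sub0r normrN => /(_ wd).
by rewrite [x + w]addrC -[f (w + x) - _ - _]addrA -opprD.
Qed.

Definition second_diff f x (u v : V) (h : R) : R :=
  f (x + h *: u + h *: v) - f (x + h *: u) - (f (x + h *: v) - f x).

Lemma derive_line f x u (s : R) : differentiable f (x + s *: u) ->
  is_derive s 1 (fun t : R => f (x + t *: u)) ('D_u f (x + s *: u)).
Proof.
move=> df.
have gd : is_diff s (fun t : R => x + t *: u) (fun t => t *: u).
  have := is_diffD (is_diff_cst x s) (is_diff_scalel s u).
  by rewrite add0r.
have fd : is_diff (x + s *: u) f ('d f (x + s *: u)) by apply: DiffDef.
have cd : is_diff s (f \o (fun t : R => x + t *: u)) ('d f (x + s *: u) \o (fun t => t *: u)).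
  exact: is_diff_comp.
apply: DeriveDef; first by apply/diff_derivable; case: cd.
rewrite deriveE; last by case: cd.
rewrite (_ : (fun t : R => f (x + t *: u)) = f \o (fun t : R => x + t *: u)) //.
rewrite (@diff_val _ _ _ _ _ _ _ cd) /= scale1r deriveE //.
Qed.

(** The mean value theorem, applied to f(x + hv + su) - f(x + su) as a function
    of s, writes the second difference as h times a difference of values of
    D_u f; the first-order expansion of D_u f at [x] then determines it up to
    o(h^2). *)
Lemma second_diff_bound f x u v : (\forall y \near x, differentiable f y) ->
  differentiable ('D_u f) x ->
  forall e : R, 0 < e -> exists2 d : R, 0 < d & forall h : R, 0 < h -> h < d ->
    `|second_diff f x u v h - h ^+ 2 * 'D_v ('D_u f) x| <= e * h ^+ 2.
Proof.
move=> /nbhs_ballP[r /= r0 fr] dD e e0.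
(* Bounds the norms of the two increments, divided by h, plus 1 so that K > 0. *)
pose K := `|u| *+ 2 + `|v| + 1.
have K0 : 0 < K by rewrite /K ltr_wpDl// addr_ge0// mulrn_wge0.
have [d d0 dP] := differentiable_eps dD (divr_gt0 e0 K0).
pose m := Num.min r d.
have m0 : 0 < m by rewrite lt_min r0 d0.
exists (m / K); first exact: divr_gt0.
move=> h h0; rewrite ltr_pdivlMr// => hK.
have small (s t : R) : 0 <= s -> s <= h -> 0 <= t -> t <= h -> `|s *: u + t *: v| < m.
  move=> s0 sh t0 th; apply: le_lt_trans hK.
  rewrite (le_trans (ler_normD _ _))// !normrZ !ger0_norm// /K.
  have := normr_ge0 u; have := normr_ge0 v; rewrite mulr2n; nra.
have frx (w : V) : `|w| < m -> differentiable f (x + w).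
  move=> wm; apply: fr; rewrite -ball_normE /= opprD addNKr normrN.
  by apply: lt_le_trans wm _; rewrite ge_min lexx.
have drx (w : V) : `|w| < m -> `|w| < d.
  by move=> wm; apply: lt_le_trans wm _; rewrite ge_min lexx orbT.
pose g (s : R) := f (x + h *: v + s *: u) - f (x + s *: u).
have gd (s : R) : 0 <= s -> s <= h ->
    is_derive s 1 g ('D_u f (x + h *: v + s *: u) - 'D_u f (x + s *: u)).
  move=> s0 sh.
  apply: is_deriveB; apply: derive_line.
    by rewrite -addrA [h *: v + _]addrC; apply/frx/small => //; exact: ltW.
  by apply/frx; have := @small s 0 s0 sh (lexx _) (ltW h0); rewrite scale0r addr0.
have [||c ch] := @MVT R g (fun s => 'D_u f (x + h *: v + s *: u) - 'D_u f (x + s *: u)) 0 h h0.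
- move=> s; rewrite in_itv /= => /andP[s0 sh]; apply: gd; exact: ltW.
- apply: derivable_within_continuous => s; rewrite in_itv /= => /andP[s0 sh].
  by case: (gd s s0 sh).
move: ch; rewrite in_itv /= => /andP[/ltW c0 /ltW ch].
rewrite subr0 /g scale0r !addr0 => gE.
have -> : second_diff f x u v h =
    ('D_u f (x + h *: v + c *: u) - 'D_u f (x + c *: u)) * h.
  by rewrite -gE /second_diff [x + h *: v + _]addrAC.
have b1 := dP _ (drx _ (small c h c0 ch (ltW h0) (lexx _))).
have c0m : `|c *: u| < m.
  by have := small c 0 c0 ch (lexx _) (ltW h0); rewrite scale0r addr0.
have b2 := dP _ (drx _ c0m).
rewrite (deriveE v dD).
have -> : x + h *: v + c *: u = x + (c *: u + h *: v) by rewrite addrAC addrA.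
have dE1 : 'd ('D_u f) x (c *: u + h *: v) =
    c *: 'd ('D_u f) x u + h *: 'd ('D_u f) x v.
  by rewrite linearD 2!linearZ.
have dE2 : 'd ('D_u f) x (c *: u) = c *: 'd ('D_u f) x u by rewrite linearZ.
move: b1 b2; rewrite dE1 dE2.
set a1 := 'D_u f (x + _); set a2 := 'D_u f (x + _); set a0 := 'D_u f x.
set B := 'd _ x v; set C := _ *: 'd _ x u.
have n1 : `|c *: u + h *: v| <= h * (`|u| + `|v|).
  rewrite (le_trans (ler_normD _ _))// !normrZ !ger0_norm ?(ltW h0)//.
  have := normr_ge0 u; have := normr_ge0 v; nra.
have n2 : `|c *: u| <= h * `|u|.
  rewrite normrZ ger0_norm//; have := normr_ge0 u; nra.
move=> b1 b2.
have regroup (r1 r2 r3 r4 r5 n n' : R) : `|r1 - r3 - (r5 + h * r4)| <= n ->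
    `|r2 - r3 - r5| <= n' -> `|(r1 - r2) * h - h ^+ 2 * r4| <= h * (n + n').
  move=> l1 l2.
  have -> : (r1 - r2) * h - h ^+ 2 * r4 =
      h * ((r1 - r3 - (r5 + h * r4)) - (r2 - r3 - r5)) by ring.
  rewrite normrM (gtr0_norm h0) ler_pM2l//.
  exact: le_trans (ler_normB _ _) (lerD l1 l2).
apply: le_trans (regroup _ _ _ _ _ _ _ b1 b2) _.
rewrite [e * _](_ : _ = h * (e * h)); last by ring.
rewrite ler_pM2l//.
rewrite -mulrDr.
have eK : 0 <= e / K by rewrite divr_ge0// ltW.
apply: le_trans (ler_wpM2l eK (lerD n1 n2)) _.
rewrite [leLHS](_ : _ = (e * h) * ((`|u| + `|v| + `|u|) / K)); last by clearbody K; ring.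
rewrite ler_piMr ?mulr_ge0 ?(ltW h0) ?(ltW e0)// ler_pdivrMr// mul1r.
by rewrite /K mulr2n; lra.
Qed.

(** The second difference is symmetric in [u] and [v], and it is approximated
    to order h^2 by h^2 times either mixed derivative. *)
Lemma derive_comm f x u v : (\forall y \near x, differentiable f y) ->
  differentiable ('D_u f) x -> differentiable ('D_v f) x ->
  'D_v ('D_u f) x = 'D_u ('D_v f) x.
Proof.
have third (r : R) : 0 < r -> r / 3 + r / 3 < r by move=> r0; lra.
move=> fx du dv; apply/eqP; rewrite -subr_eq0 -normr_eq0.
apply/negPn/negP => n0.
set a := 'D_v _ _ in n0 *; set b := 'D_u _ _ in n0 *.
have ab : 0 < `|a - b| by rewrite lt_neqAle eq_sym n0 normr_ge0.
pose e := `|a - b| / 3.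
have e0 : 0 < e by rewrite divr_gt0.
have [d1 d10 B1] := second_diff_bound v fx du e0.
have [d2 d20 B2] := second_diff_bound u fx dv e0.
pose h := Num.min d1 d2 / 2.
have m0 : 0 < Num.min d1 d2 by rewrite lt_min d10 d20.
have h0 : 0 < h by rewrite divr_gt0.
have hm : h < Num.min d1 d2 by rewrite /h; lra.
have h1 : h < d1 by apply: lt_le_trans hm _; rewrite ge_min lexx.
have h2 : h < d2 by apply: lt_le_trans hm _; rewrite ge_min lexx orbT.
have := B1 h h0 h1; have := B2 h h0 h2.
have -> : second_diff f x v u h = second_diff f x u v h.
  by rewrite /second_diff [x + h *: v + _]addrAC; ring.
set D := second_diff _ _ _ _ _; rewrite -/a -/b => b2 b1.
have : `|h ^+ 2 * (a - b)| <= e * h ^+ 2 + e * h ^+ 2.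
  rewrite (_ : h ^+ 2 * (a - b) = (D - h ^+ 2 * b) - (D - h ^+ 2 * a)); last by ring.
  exact: le_trans (ler_normB _ _) (lerD b2 b1).
have hh : 0 < h ^+ 2 by rewrite exprn_gt0.
rewrite normrM gtr0_norm// -mulrDl mulrC ler_pM2r// leNgt => /negP; apply.
exact: third.
Qed.

End Schwarz.

Section SmoothPlane.
Variable R : realType.
Implicit Types (D : set (R * R)) (f g : R * R -> R).

(** The iterated derivatives of order at most [n] are differentiable.  The
    index makes closure under products and inverses provable by induction,
    since Leibniz' rule expresses a derivative of order n+1 through products
    of functions of order n. *)
Definition smoothn n D f := forall s : seq (R * R), (size s <= n)%N ->
  forall x, D x ->
    differentiable (foldr (fun v h => fun y => 'D_v h y) f s : R * R -> R) x.

Lemma smooth_planeP D f : smooth_plane D f <-> forall n, smoothn n D f.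
Proof.
split=> [fs n s _ x|fs s x]; first exact: fs.
exact: (fs (size s)).
Qed.

Lemma smoothnS n D f : smoothn n.+1 D f <->
  (forall x, D x -> differentiable f x) /\ forall v, smoothn n D (fun y => 'D_v f y).
Proof.
split=> [fs|[df fs] s].
  split=> [x|v s sn]; first exact: (fs [::]).
  by have := fs (rcons s v); rewrite size_rcons foldr_rcons; apply.
case/lastP: s => [_|s v]; first exact: df.
by rewrite size_rcons foldr_rcons; apply: fs.
Qed.

Lemma smoothn_diff n D f x : smoothn n D f -> D x -> differentiable f x.
Proof. by move=> fs; exact: (fs [::]). Qed.

Lemma smoothnW n D f : smoothn n.+1 D f -> smoothn n D f.
Proof. by move=> fs s sn; apply: fs; exact: leqW. Qed.

Lemma smoothn_eq n D f g : open D -> (forall x, D x -> f x = g x) ->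
  smoothn n D f -> smoothn n D g.
Proof.
move=> oD; elim: n f g => [|n IH] f g fg fs.
  move=> [|//] _ x Dx /=.
  apply: near_eq_differentiable (smoothn_diff fs Dx).
  by near=> y; apply: fg; near: y; exact: open_nbhs_nbhs.
have [df dvf] := (smoothnS _ _ _).1 fs.
apply/smoothnS; split=> [x Dx|v].
  apply: near_eq_differentiable (df _ Dx).
  by near=> y; apply: fg; near: y; exact: open_nbhs_nbhs.
apply: IH (dvf v) => x Dx; apply: near_eq_derive.
by near=> y; apply: fg; near: y; exact: open_nbhs_nbhs.
Unshelve. all: by end_near. Qed.

Lemma smoothn_cst n D (a : R) : smoothn n D (cst a).
Proof.
elim: n a => [|n IH] a; first by move=> [|//] _ x _; exact: differentiable_cst.
apply/smoothnS; split=> [x _|v]; first exact: differentiable_cst.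
rewrite (_ : (fun _ => _) = cst 0); first exact: IH.
by apply/funext => y; rewrite derive_cst.
Qed.

Lemma smoothnD n D f g : open D -> smoothn n D f -> smoothn n D g ->
  smoothn n D (fun x => f x + g x).
Proof.
move=> oD; elim: n f g => [|n IH] f g fs gs.
  move=> [|//] _ x Dx; apply: (@differentiableD _ _ _ f g x).
    exact: smoothn_diff fs Dx.
  exact: smoothn_diff gs Dx.
have [df dvf] := (smoothnS _ _ _).1 fs; have [dg dvg] := (smoothnS _ _ _).1 gs.
apply/smoothnS; split=> [x Dx|v].
  by apply: (@differentiableD _ _ _ f g x); [exact: df|exact: dg].
apply: smoothn_eq oD _ (IH _ _ (dvf v) (dvg v)) => x Dx.
by rewrite -deriveD //; apply: diff_derivable; [exact: df|exact: dg].
Qed.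

Lemma smoothnM n D f g : open D -> smoothn n D f -> smoothn n D g ->
  smoothn n D (fun x => f x * g x).
Proof.
move=> oD; elim: n f g => [|n IH] f g fs gs.
  move=> [|//] _ x Dx; apply: (@differentiableM _ _ f g x).
    exact: smoothn_diff fs Dx.
  exact: smoothn_diff gs Dx.
have [df dvf] := (smoothnS _ _ _).1 fs; have [dg dvg] := (smoothnS _ _ _).1 gs.
apply/smoothnS; split=> [x Dx|v].
  by apply: (@differentiableM _ _ f g x); [exact: df|exact: dg].
apply: smoothn_eq oD _ (smoothnD oD (IH _ _ (smoothnW fs) (dvg v))
  (IH _ _ (smoothnW gs) (dvf v))) => x Dx.
by rewrite -[LHS]deriveM //; apply: diff_derivable; [exact: df|exact: dg].
Qed.

Lemma smoothnV n D f : open D -> (forall x, D x -> f x != 0) ->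
  smoothn n D f -> smoothn n D (fun x => (f x)^-1).
Proof.
move=> oD f0; elim: n => [|n IH] fs.
  move=> [|//] _ x Dx; apply: (@differentiableV _ _ f x); last exact: f0.
  exact: smoothn_diff fs Dx.
have [df dvf] := (smoothnS _ _ _).1 fs.
apply/smoothnS; split=> [x Dx|v].
  by apply: (@differentiableV _ _ f x); [exact: df|exact: f0].
have iv := IH (smoothnW fs).
have prod := smoothnM oD (@smoothn_cst n D (-1))
  (smoothnM oD (smoothnM oD iv iv) (dvf v)).
apply: smoothn_eq oD _ prod => x Dx.
rewrite (@deriveV _ _ f x v (f0 _ Dx)); last by apply: diff_derivable; exact: df.
by rewrite mulN1r -exprVn expr2 -mulNr.
Qed.

Lemma smooth_plane_eq D f g : open D -> (forall x, D x -> f x = g x) ->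
  smooth_plane D f -> smooth_plane D g.
Proof. by move=> oD fg /smooth_planeP fs; apply/smooth_planeP => n; apply: smoothn_eq oD fg (fs n). Qed.

Lemma smooth_plane_cst D (a : R) : smooth_plane D (fun=> a).
Proof. by apply/smooth_planeP => n; apply: smoothn_cst. Qed.

Lemma smooth_planeD D f g : open D -> smooth_plane D f -> smooth_plane D g ->
  smooth_plane D (fun x => f x + g x).
Proof.
move=> oD /smooth_planeP fs /smooth_planeP gs; apply/smooth_planeP => n.
exact: smoothnD oD (fs n) (gs n).
Qed.

Lemma smooth_planeM D f g : open D -> smooth_plane D f -> smooth_plane D g ->
  smooth_plane D (fun x => f x * g x).
Proof.
move=> oD /smooth_planeP fs /smooth_planeP gs; apply/smooth_planeP => n.
exact: smoothnM oD (fs n) (gs n).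
Qed.

Lemma smooth_planeN D f : open D -> smooth_plane D f ->
  smooth_plane D (fun x => - f x).
Proof.
move=> oD fs; apply: smooth_plane_eq oD _
  (smooth_planeM oD (@smooth_plane_cst D (-1)) fs) => x _.
by rewrite mulN1r.
Qed.

Lemma smooth_planeV D f : open D -> (forall x, D x -> f x != 0) ->
  smooth_plane D f -> smooth_plane D (fun x => (f x)^-1).
Proof.
move=> oD f0 /smooth_planeP fs; apply/smooth_planeP => n.
exact: smoothnV oD f0 (fs n).
Qed.

Lemma smooth_plane_derive D f v : smooth_plane D f ->
  smooth_plane D (fun x => 'D_v f x).
Proof. by move=> fs s x Dx; have := fs (rcons s v) x Dx; rewrite foldr_rcons. Qed.

Lemma smooth_plane_diff D f x : smooth_plane D f -> D x -> differentiable f x.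
Proof. by move=> fs; exact: (fs [::]). Qed.

Lemma smooth_plane_sub D D' f : D' `<=` D -> smooth_plane D f ->
  smooth_plane D' f.
Proof. by move=> DD fs s x /DD; exact: fs. Qed.

End SmoothPlane.

(** * Real functions on a Riemann surface, in charts *)

Section Charts.
Variables (R : realType) (M : topologicalType).
Implicit Types (c : chart R M) (V : set M) (p : M).

Lemma cinv_cvg c p : cdom c p -> cinv c x @[x --> cmap c p] --> p.
Proof.
move=> cp; have := @cinv_continuous _ _ c.
rewrite continuous_open_subspace; last exact: crange_open.
move=> /(_ (cmap c p)); rewrite /prop_for /continuous_at cmapK //; apply.
by apply/mem_set; exists p.
Qed.

Lemma cmap_cvg c p : cdom c p -> cmap c q @[q --> p] --> cmap c p.
Proof.
move=> cp; have := @cmap_continuous _ _ c.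
rewrite continuous_open_subspace; last exact: cdom_open.
by move=> /(_ p); apply; apply/mem_set.
Qed.

Lemma near_cinv c p (P : M -> Prop) : cdom c p ->
  (\forall q \near p, P q) -> \forall x \near cmap c p, P (cinv c x).
Proof. by move=> cp Pp; exact: (cinv_cvg cp). Qed.

Lemma near_cdom c p : cdom c p -> \forall q \near p, cdom c q.
Proof. by move=> cp; apply: open_nbhs_nbhs; split=> //; exact: cdom_open. Qed.

(** The image is the preimage of [V] under the continuous inverse chart, inside
    the open range of the chart. *)
Lemma cmap_open c V : open V -> open (cmap c @` (V `&` cdom c)).
Proof.
move=> oV; rewrite openE => _ [p [Vp cp] <-].
have Vn : \forall q \near p, (V `&` cdom c) q.
  by near=> q; split; near: q; [exact: open_nbhs_nbhs|exact: near_cdom].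
have rn : \forall x \near cmap c p, (cmap c @` cdom c) x.
  by apply: open_nbhs_nbhs; split; [exact: crange_open|exists p].
rewrite /interior /=.
apply: filterS2 rn (near_cinv cp Vn) => x [q cq <-] [Vx cx].
by exists q => //; split=> //; rewrite cmapK in Vx.
Unshelve. all: by end_near. Qed.

End Charts.

Section RealCalculus.
Variables (R : realType) (M : riemannSurface R).
Implicit Types (c : chart R M) (V : set M) (p : M) (f g : M -> R) (X Y : R * R).

Definition diffR c p f := differentiable (f \o cinv c) (cmap c p).

(** Smoothness in a single chart.  The functions built from derivatives along
    coordinate fields depend on the chart, and only in that chart can they be
    shown to be smooth. *)
Definition smoothR_in c V f :=
  smooth_plane (cmap c @` (V `&` cdom c)) (f \o cinv c).

Lemma smoothR_in_diff c V f p : smoothR_in c V f -> V p -> cdom c p ->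
  diffR c p f.
Proof. by move=> fs Vp cp; apply: smooth_plane_diff fs _; exists p. Qed.

Lemma dR_near c p f g X : cdom c p -> (\forall q \near p, f q = g q) ->
  dR c f p X = dR c g p X.
Proof. by move=> cp fg; apply: near_eq_derive; exact: near_cinv cp fg. Qed.

Lemma diffR_near c p f g : cdom c p -> (\forall q \near p, f q = g q) ->
  diffR c p f -> diffR c p g.
Proof. by move=> cp fg; apply: near_eq_differentiable; exact: near_cinv cp fg. Qed.

Lemma dR_cst c p (a : R) X : dR c (fun=> a) p X = 0.
Proof. exact: derive_cst. Qed.

Lemma dRD c p f g X : diffR c p f -> diffR c p g ->
  dR c (fun q => f q + g q) p X = dR c f p X + dR c g p X.
Proof. by move=> df dg; rewrite /dR -deriveD //; exact: diff_derivable. Qed.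

Lemma dRN c p f X : diffR c p f -> dR c (fun q => - f q) p X = - dR c f p X.
Proof. by move=> df; rewrite /dR -deriveN //; exact: diff_derivable. Qed.

Lemma dRM c p f g X : cdom c p -> diffR c p f -> diffR c p g ->
  dR c (fun q => f q * g q) p X = dR c f p X * g p + f p * dR c g p X.
Proof.
move=> cp df dg; rewrite /dR.
have := @deriveM _ _ (f \o cinv c) (g \o cinv c) (cmap c p) X (diff_derivable df) (diff_derivable dg).
rewrite /= cmapK // => ->; rewrite addrC; congr (_ + _).
exact: mulrC.
Qed.

Lemma dR_lin c p f (a b : R) X Y : diffR c p f ->
  dR c f p (a *: X + b *: Y) = a * dR c f p X + b * dR c f p Y.
Proof.
by move=> df; rewrite /dR !deriveE // linearD 2!linearZ.
Qed.

(** Differentiability at a point and smoothness are used only through these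
    closure properties, so that the extension to quaternions and matrices is
    done once for both. *)
Definition subalgebra (P : (M -> R) -> Prop) :=
  [/\ forall a : R, P (fun=> a),
      forall f g, P f -> P g -> P (fun q => f q + g q),
      forall f, P f -> P (fun q => - f q) &
      forall f g, P f -> P g -> P (fun q => f q * g q)].

Lemma diffR_subalgebra c p : subalgebra (diffR c p).
Proof.
split=> [a|f g df dg|f df|f g df dg].
- exact: differentiable_cst.
- exact: (@differentiableD _ _ _ (f \o cinv c) (g \o cinv c)).
- exact: (@differentiableN _ _ _ (f \o cinv c)).
- exact: (@differentiableM _ _ (f \o cinv c) (g \o cinv c)).
Qed.

Lemma smoothR_in_subalgebra c V : open V -> subalgebra (smoothR_in c V).
Proof.
move=> oV; have oD := @cmap_open _ _ c _ oV.
split=> [a|f g|f|f g]; rewrite /smoothR_in.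
- exact: smooth_plane_cst.
- exact: smooth_planeD.
- exact: smooth_planeN.
- exact: smooth_planeM.
Qed.

Lemma smoothR_subalgebra V : open V -> subalgebra (smoothR V).
Proof.
move=> oV; split=> [a|f g fs gs|f fs|f g fs gs] c ac;
  have [H1 H2 H3 H4] := @smoothR_in_subalgebra c _ oV.
- exact: H1.
- exact: H2 (fs c ac) (gs c ac).
- exact: H3 (fs c ac).
- exact: H4 (fs c ac) (gs c ac).
Qed.

Lemma smoothR_in_eq c V f g : open V -> (forall q, V q -> cdom c q -> f q = g q) ->
  smoothR_in c V f -> smoothR_in c V g.
Proof.
move=> oV fg; apply: smooth_plane_eq; first exact: cmap_open.
by move=> _ [p [Vp cp] <-] /=; rewrite cmapK // fg.
Qed.

Lemma smoothR_inV c V f : open V -> (forall q, V q -> cdom c q -> f q != 0) ->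
  smoothR_in c V f -> smoothR_in c V (fun q => (f q)^-1).
Proof.
move=> oV f0; apply: smooth_planeV; first exact: cmap_open.
by move=> _ [p [Vp cp] <-] /=; rewrite cmapK // f0.
Qed.

Lemma smoothR_in_dR c V f X : open V -> smoothR_in c V f ->
  smoothR_in c V (fun q => dR c f q X).
Proof.
move=> oV fs; apply: smooth_plane_eq (smooth_plane_derive X fs).
  exact: cmap_open.
by move=> _ [p [Vp cp] <-] /=; rewrite /dR cmapK.
Qed.

Lemma smoothR_in_sub c V V' f : V' `<=` V -> smoothR_in c V f ->
  smoothR_in c V' f.
Proof.
by move=> VV; apply: smooth_plane_sub => _ [p [/VV Vp cp] <-]; exists p.
Qed.

Lemma smoothR_in_local c V f : (forall p, V p -> cdom c p ->
  exists V', [/\ V' p & smoothR_in c V' f]) -> smoothR_in c V f.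
Proof.
move=> H s _ [p [Vp cp] <-]; have [V' [V'p fs]] := H p Vp cp.
by apply: fs; exists p.
Qed.

Lemma dR_comm c V f p X Y : open V -> smoothR_in c V f -> V p -> cdom c p ->
  dR c (fun q => dR c f q X) p Y = dR c (fun q => dR c f q Y) p X.
Proof.
move=> oV fs Vp cp; have oD := @cmap_open _ _ c _ oV.
have Dp : (cmap c @` (V `&` cdom c)) (cmap c p) by exists p.
have nD : \forall x \near cmap c p, (cmap c @` (V `&` cdom c)) x.
  exact: open_nbhs_nbhs.
have E Z Z' : dR c (fun q => dR c f q Z) p Z' =
    'D_Z' ('D_Z (f \o cinv c)) (cmap c p).
  apply: near_eq_derive; apply: filterS nD => _ [q [Vq cq] <-] /=.
  by rewrite /dR cmapK.
rewrite !E; apply: derive_comm.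
- by apply: filterS nD => x Dx; exact: smooth_plane_diff fs Dx.
- exact: smooth_plane_diff (smooth_plane_derive X fs) Dp.
- exact: smooth_plane_diff (smooth_plane_derive Y fs) Dp.
Qed.

Lemma smoothR_in_continuous c V f p : open V -> smoothR_in c V f -> V p ->
  cdom c p -> f q @[q --> p] --> f p.
Proof.
move=> oV fs Vp cp; have df := smoothR_in_diff fs Vp cp.
have /= cf := differentiable_continuous df.
have : (f \o cinv c) (cmap c q) @[q --> p] --> (f \o cinv c) (cmap c p).
  exact: cvg_comp (cmap_cvg cp) cf.
rewrite /= cmapK //; apply: cvg_trans; apply: near_eq_cvg.
by apply: filterS (near_cdom cp) => q cq; rewrite /= cmapK.
Qed.

(** The chain rule for the transition map, which is differentiable. *)
Lemma dR_chart c c' p f X : atlas c -> atlas c' -> cdom c p -> cdom c' p ->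
  diffR c' p f ->
  diffR c p f /\
  dR c f p X = dR c' f p ('d (cmap c' \o cinv c) (cmap c p) X).
Proof.
move=> ac ac' cp cp' df.
have [dtau _] := atlas_holomorphic ac ac' cp cp'.
have E : \forall x \near cmap c p,
    ((f \o cinv c') \o (cmap c' \o cinv c)) x = (f \o cinv c) x.
  have fE : \forall q \near p, f (cinv c' (cmap c' q)) = f q.
    by apply: filterS (near_cdom cp') => q cq; rewrite cmapK.
  exact: near_cinv cp fE.
have df' : differentiable (f \o cinv c') ((cmap c' \o cinv c) (cmap c p)).
  by rewrite /= cmapK.
have dc := differentiable_comp dtau df'.
split; first exact: near_eq_differentiable E dc.
rewrite /dR -(near_eq_derive _ E) deriveE // diff_comp //= cmapK //.
by rewrite deriveE.
Qed.

End RealCalculus.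

(** * Differential calculus of quaternionic matrices *)

Section QuatFacts.
Variable R : realType.
Implicit Types x y : quat R.

Lemma quatP x y : [/\ qr x = qr y, qi x = qi y, qj x = qj y & qk x = qk y] ->
  x = y.
Proof. by case: x y => [a b c d] [a' b' c' d'] /= [-> -> -> ->]. Qed.

Lemma qaddE x y : x + y =
  Quat (qr x + qr y) (qi x + qi y) (qj x + qj y) (qk x + qk y).
Proof. by []. Qed.
Lemma qoppE x : - x = Quat (- qr x) (- qi x) (- qj x) (- qk x).
Proof. by []. Qed.
Lemma q0E : (0 : quat R) = Quat 0 0 0 0. Proof. by []. Qed.
Lemma q1E : (1 : quat R) = Quat 1 0 0 0. Proof. by []. Qed.
Lemma qmulE x y : x * y = Quat
  (qr x * qr y - qi x * qi y - qj x * qj y - qk x * qk y)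
  (qr x * qi y + qi x * qr y + qj x * qk y - qk x * qj y)
  (qr x * qj y - qi x * qk y + qj x * qr y + qk x * qi y)
  (qr x * qk y + qi x * qj y - qj x * qi y + qk x * qr y).
Proof. by []. Qed.

Lemma realqM (a : R) x : realq a * x = x * realq a.
Proof. by apply/quatP; rewrite !qmulE /=; split; ring. Qed.

Lemma realq_scale (a : R) x : realq a * x =
  Quat (a * qr x) (a * qi x) (a * qj x) (a * qk x).
Proof. by apply/quatP; rewrite !qmulE /=; split; ring. Qed.

Definition qnorm2 x : R := qr x * qr x + qi x * qi x + qj x * qj x + qk x * qk x.

Definition qinv x : quat R := Quat (qr x * (qnorm2 x)^-1) (- (qi x * (qnorm2 x)^-1))
  (- (qj x * (qnorm2 x)^-1)) (- (qk x * (qnorm2 x)^-1)).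

Lemma qnorm2_eq0 x : qnorm2 x = 0 -> x = 0.
Proof.
move=> /eqP; rewrite /qnorm2 -!expr2 !paddr_eq0 ?addr_ge0 ?sqr_ge0// !sqrf_eq0.
by move=> /andP[/andP[/andP[/eqP a /eqP b] /eqP c] /eqP d]; apply/quatP; rewrite a b c d.
Qed.

Lemma qmulV x : x <> 0 -> x * qinv x = 1.
Proof.
move=> x0; have n0 : qnorm2 x != 0 by apply/eqP => /qnorm2_eq0.
have nE : qnorm2 x * (qnorm2 x)^-1 = 1 by rewrite divff.
rewrite qmulE /= q1E; move: nE; set n := (qnorm2 x)^-1 => nE.
by apply/quatP => /=; split; [rewrite -nE /qnorm2|..]; ring.
Qed.

Lemma qmulVl x : x <> 0 -> qinv x * x = 1.
Proof.
move=> x0; have n0 : qnorm2 x != 0 by apply/eqP => /qnorm2_eq0.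
have nE : qnorm2 x * (qnorm2 x)^-1 = 1 by rewrite divff.
rewrite qmulE /= q1E; move: nE; set n := (qnorm2 x)^-1 => nE.
by apply/quatP => /=; split; [rewrite -nE /qnorm2|..]; ring.
Qed.

End QuatFacts.

(** Scaling by a real number, which is central in the quaternions.  It is
    locked because it would otherwise be unfolded and compared with matrix
    products during rewriting. *)
Definition rsc (R : realType) m n : R -> 'M[quat R]_(m, n) -> 'M[quat R]_(m, n) :=
  locked (fun a A => realq a *: A).

Lemma rscE (R : realType) m n (a : R) (A : 'M[quat R]_(m, n)) :
  rsc a A = realq a *: A.
Proof. by rewrite /rsc -lock. Qed.

Section Componentwise.
Variables (R : realType) (M : riemannSurface R).

(** All real components of a quaternionic, respectively matrix-valued, map
    satisfy [P]. *)
Definition hwise (P : (M -> R) -> Prop) (f : M -> quat R) :=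
  [/\ P (@qr R \o f), P (@qi R \o f), P (@qj R \o f) & P (@qk R \o f)].

Definition mwise (P : (M -> R) -> Prop) m n (F : M -> 'M[quat R]_(m, n)) :=
  forall i j, hwise P (fun q => F q i j).

Variable P : (M -> R) -> Prop.
Hypothesis HP : subalgebra P.

Lemma hwise_cst a : hwise P (fun=> a).
Proof. by case: HP => H _ _ _; split; exact: H. Qed.

Lemma hwiseD f g : hwise P f -> hwise P g -> hwise P (fun q => f q + g q).
Proof.
case: HP => _ D _ _ [f1 f2 f3 f4] [g1 g2 g3 g4].
by split; [exact: D f1 g1|exact: D f2 g2|exact: D f3 g3|exact: D f4 g4].
Qed.

Lemma hwiseN f : hwise P f -> hwise P (fun q => - f q).
Proof.
case: HP => _ _ N _ [f1 f2 f3 f4].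
by split; [exact: N f1|exact: N f2|exact: N f3|exact: N f4].
Qed.

Lemma hwiseM f g : hwise P f -> hwise P g -> hwise P (fun q => f q * g q).
Proof.
case: HP => _ D N T [f1 f2 f3 f4] [g1 g2 g3 g4].
have B a b : P a -> P b -> P (fun q => a q - b q) by move=> Pa Pb; apply: D (N _ _).
split.
- exact: B (B _ _ (B _ _ (T _ _ f1 g1) (T _ _ f2 g2)) (T _ _ f3 g3)) (T _ _ f4 g4).
- exact: B (D _ _ (D _ _ (T _ _ f1 g2) (T _ _ f2 g1)) (T _ _ f3 g4)) (T _ _ f4 g3).
- exact: D (D _ _ (B _ _ (T _ _ f1 g3) (T _ _ f2 g4)) (T _ _ f3 g1)) (T _ _ f4 g2).
- exact: D (B _ _ (D _ _ (T _ _ f1 g4) (T _ _ f2 g3)) (T _ _ f3 g2)) (T _ _ f4 g1).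
Qed.

Lemma hwise_sum n (f : 'I_n -> M -> quat R) : (forall k, hwise P (f k)) ->
  hwise P (fun q => \sum_k f k q).
Proof.
elim: n f => [|n IH] f fP.
  rewrite (_ : (fun _ => _) = fun=> 0); first exact: hwise_cst.
  by apply/funext => q; rewrite big_ord0.
rewrite (_ : (fun _ => _) = fun q => f ord0 q + \sum_k f (lift ord0 k) q).
  by apply: hwiseD => //; apply: IH => k; exact: fP.
by apply/funext => q; rewrite big_ord_recl.
Qed.

Lemma mwise_cst m n (A : 'M[quat R]_(m, n)) : mwise P (fun=> A).
Proof. by move=> i j; exact: hwise_cst. Qed.

Lemma mwiseD m n (F G : M -> 'M[quat R]_(m, n)) : mwise P F -> mwise P G ->
  mwise P (fun q => F q + G q).
Proof.
move=> FP GP i j; rewrite (_ : (fun q => _) = fun q => F q i j + G q i j).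
  exact: hwiseD.
by apply/funext => q; rewrite mxE.
Qed.

Lemma mwiseN m n (F : M -> 'M[quat R]_(m, n)) : mwise P F ->
  mwise P (fun q => - F q).
Proof.
move=> FP i j; rewrite (_ : (fun q => _) = fun q => - F q i j).
  exact: hwiseN.
by apply/funext => q; rewrite mxE.
Qed.

Lemma mwiseB m n (F G : M -> 'M[quat R]_(m, n)) : mwise P F -> mwise P G ->
  mwise P (fun q => F q - G q).
Proof. by move=> FP GP; apply: mwiseD => //; exact: mwiseN. Qed.

Lemma mwiseM m n k (F : M -> 'M[quat R]_(m, n)) (G : M -> 'M[quat R]_(n, k)) :
  mwise P F -> mwise P G -> mwise P (fun q => F q *m G q).
Proof.
move=> FP GP i j.
rewrite (_ : (fun q => _) = fun q => \sum_l F q i l * G q l j).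
  by apply: hwise_sum => l; exact: hwiseM.
by apply/funext => q; rewrite mxE.
Qed.

End Componentwise.

Section Differential.
Variables (R : realType) (M : riemannSurface R).
Implicit Types (c : chart R M) (V : set M) (p : M) (X Y : R * R).

Definition mdiff c p m n (F : M -> 'M[quat R]_(m, n)) := mwise (diffR c p) F.
Definition smooth_in c V m n (F : M -> 'M[quat R]_(m, n)) :=
  mwise (smoothR_in c V) F.

Lemma smoothP V m n (F : M -> 'M[quat R]_(m, n)) :
  smooth V F <-> forall c, atlas c -> smooth_in c V F.
Proof.
split=> [FS c ac i j|FS i j].
  by have [a b d e] := FS i j; split; [exact: a|exact: b|exact: d|exact: e].
by split=> c ac; have [a b d e] := FS c ac i j.
Qed.

Lemma mwiseP (P Q : (M -> R) -> Prop) m n (F : M -> 'M[quat R]_(m, n)) :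
  (forall f, P f -> Q f) -> mwise P F -> mwise Q F.
Proof. by move=> PQ FP i j; have [a b d e] := FP i j; split; exact: PQ. Qed.

Lemma smooth_in_diff c V p m n (F : M -> 'M[quat R]_(m, n)) :
  smooth_in c V F -> V p -> cdom c p -> mdiff c p F.
Proof. by move=> FS Vp cp; apply: mwiseP FS => f fs; exact: smoothR_in_diff fs Vp cp. Qed.

Lemma smooth_in_sub c V V' m n (F : M -> 'M[quat R]_(m, n)) :
  V' `<=` V -> smooth_in c V F -> smooth_in c V' F.
Proof. by move=> VV; apply: mwiseP => f; exact: smoothR_in_sub. Qed.

Lemma smooth_sub V V' m n (F : M -> 'M[quat R]_(m, n)) :
  V' `<=` V -> smooth V F -> smooth V' F.
Proof.
move=> VV /smoothP FS; apply/smoothP => c ac; exact: smooth_in_sub VV (FS c ac).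
Qed.

Lemma smooth_in_eq c V m n (F G : M -> 'M[quat R]_(m, n)) : open V ->
  (forall q, V q -> cdom c q -> F q = G q) -> smooth_in c V F -> smooth_in c V G.
Proof.
move=> oV FG FS i j; have [a b d e] := FS i j.
by split; [apply: smoothR_in_eq a|apply: smoothR_in_eq b
          |apply: smoothR_in_eq d|apply: smoothR_in_eq e] => //= q Vq cq; rewrite FG.
Qed.

Lemma smooth_in_local c V m n (F : M -> 'M[quat R]_(m, n)) :
  (forall p, V p -> cdom c p -> exists V', V' p /\ smooth_in c V' F) ->
  smooth_in c V F.
Proof.
move=> H i j; split; apply: smoothR_in_local => p Vp cp;
  have [V' [V'p FS]] := H p Vp cp; exists V'; split=> //;
  by have [a b d e] := FS i j.
Qed.

Lemma smooth_in_dM c V m n (F : M -> 'M[quat R]_(m, n)) X : open V ->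
  smooth_in c V F -> smooth_in c V (fun q => dM c F q X).
Proof.
move=> oV FS i j.
rewrite (_ : (fun q => _) = fun q => dH c (fun q' => F q' i j) q X).
  by have [a b d e] := FS i j; split; exact: smoothR_in_dR.
by apply/funext => q; rewrite mxE.
Qed.

(** Quaternionic functions are treated as 1 x 1 matrices, so that a single
    product rule covers sections, endomorphisms and coefficients. *)
Definition inv1 (A : 'M[quat R]_1) : 'M[quat R]_1 := (qinv (A 0 0))%:M.

Lemma mx11_neq0 (A : 'M[quat R]_1) : A <> 0 -> A 0 0 <> 0.
Proof. by move=> A0 a0; apply: A0; rewrite [A]mx11_scalar a0; apply/matrixP => i j; rewrite !mxE mul0rn. Qed.

Lemma mulm1V (A : 'M[quat R]_1) : A <> 0 -> A *m inv1 A = 1%:M.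
Proof.
by move=> /mx11_neq0 A0; rewrite {1}[A]mx11_scalar -scalar_mxM qmulV.
Qed.

Lemma mulm1Vl (A : 'M[quat R]_1) : A <> 0 -> inv1 A *m A = 1%:M.
Proof.
by move=> /mx11_neq0 A0; rewrite {2}[A]mx11_scalar -scalar_mxM qmulVl.
Qed.

Lemma smooth_in_inv1 c V (F : M -> 'M[quat R]_1) : open V ->
  (forall q, V q -> cdom c q -> F q <> 0) -> smooth_in c V F ->
  smooth_in c V (fun q => inv1 (F q)).
Proof.
move=> oV F0 FS i j.
rewrite (_ : (fun q => _) = fun q => qinv (F q 0 0)); last first.
  by apply/funext => q; rewrite mxE !ord1.
have [a b d e] := FS 0 0.
have [_ D N T] := @smoothR_in_subalgebra _ _ c _ oV.
have nV : smoothR_in c V (fun q => (qnorm2 (F q 0 0))^-1).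
  apply: smoothR_inV => // [q Vq cq|].
    by apply/eqP => /qnorm2_eq0; apply/mx11_neq0/F0.
  exact: D (D _ _ (D _ _ (T _ _ a a) (T _ _ b b)) (T _ _ d d)) (T _ _ e e).
by split; [exact: T a nV|exact: N (T _ _ b nV)|exact: N (T _ _ d nV)|exact: N (T _ _ e nV)].
Qed.

Lemma dH_near c p (f g : M -> quat R) X : cdom c p ->
  (\forall q \near p, f q = g q) -> dH c f p X = dH c g p X.
Proof.
move=> cp fg; congr Quat; apply: dR_near => //;
  by apply: filterS fg => q /= ->.
Qed.

Lemma dH_ext c p (f g : M -> quat R) X : f =1 g -> dH c f p X = dH c g p X.
Proof. by move=> /funext ->. Qed.

Lemma dH_lin c p (f : M -> quat R) (a b : R) X Y : hwise (diffR c p) f ->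
  dH c f p (a *: X + b *: Y) = realq a * dH c f p X + realq b * dH c f p Y.
Proof.
move=> [f1 f2 f3 f4]; rewrite (realq_scale a) (realq_scale b) qaddE.
by congr Quat; exact: dR_lin.
Qed.

Lemma dHD c p (f g : M -> quat R) X : hwise (diffR c p) f -> hwise (diffR c p) g ->
  dH c (fun q => f q + g q) p X = dH c f p X + dH c g p X.
Proof.
move=> [f1 f2 f3 f4] [g1 g2 g3 g4]; rewrite qaddE; congr Quat;
  exact: dRD.
Qed.

Lemma dHN c p (f : M -> quat R) X : hwise (diffR c p) f ->
  dH c (fun q => - f q) p X = - dH c f p X.
Proof. by move=> [f1 f2 f3 f4]; rewrite qoppE; congr Quat; exact: dRN. Qed.

Lemma dH_cst c p (a : quat R) X : dH c (fun=> a) p X = 0.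
Proof. by rewrite q0E; congr Quat; exact: dR_cst. Qed.

Lemma dHM c p (f g : M -> quat R) X : cdom c p -> hwise (diffR c p) f ->
  hwise (diffR c p) g ->
  dH c (fun q => f q * g q) p X = dH c f p X * g p + f p * dH c g p X.
Proof.
move=> cp [f1 f2 f3 f4] [g1 g2 g3 g4].
have [_ D N T] := diffR_subalgebra c p.
pose is_dR (a : M -> R) (da : R) := diffR c p a /\ dR c a p X = da.
have mul a b : diffR c p a -> diffR c p b ->
    is_dR (fun q => a q * b q) (dR c a p X * b p + a p * dR c b p X).
  by move=> da db; split; [exact: T|exact: dRM].
have add a b x y : is_dR a x -> is_dR b y -> is_dR (fun q => a q + b q) (x + y).
  by move=> [da <-] [db <-]; split; [exact: D|exact: dRD].
have sub a b x y : is_dR a x -> is_dR b y -> is_dR (fun q => a q - b q) (x - y).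
  move=> ax [db <-]; apply: add ax _; split; [exact: N|exact: dRN].
have [_ e1] := sub _ _ _ _ (sub _ _ _ _ (sub _ _ _ _ (mul _ _ f1 g1) (mul _ _ f2 g2))
  (mul _ _ f3 g3)) (mul _ _ f4 g4).
have [_ e2] := sub _ _ _ _ (add _ _ _ _ (add _ _ _ _ (mul _ _ f1 g2) (mul _ _ f2 g1))
  (mul _ _ f3 g4)) (mul _ _ f4 g3).
have [_ e3] := add _ _ _ _ (add _ _ _ _ (sub _ _ _ _ (mul _ _ f1 g3) (mul _ _ f2 g4))
  (mul _ _ f3 g1)) (mul _ _ f4 g2).
have [_ e4] := add _ _ _ _ (sub _ _ _ _ (add _ _ _ _ (mul _ _ f1 g4) (mul _ _ f2 g3))
  (mul _ _ f3 g2)) (mul _ _ f4 g1).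
rewrite qaddE !qmulE; apply/quatP; split.
- by apply: etrans e1 _ => /=; ring.
- by apply: etrans e2 _ => /=; ring.
- by apply: etrans e3 _ => /=; ring.
- by apply: etrans e4 _ => /=; ring.
Qed.

Lemma dH_sum c p n (f : 'I_n -> M -> quat R) X :
  (forall k, hwise (diffR c p) (f k)) ->
  dH c (fun q => \sum_k f k q) p X = \sum_k dH c (f k) p X.
Proof.
elim: n f => [|n IH] f df.
  have -> : (fun q => \sum_k f k q) = fun=> 0.
    by apply/funext => q; rewrite big_ord0.
  by rewrite big_ord0 dH_cst.
rewrite big_ord_recl -IH // -dHD //; last first.
  by apply: hwise_sum; [exact: diffR_subalgebra|move=> k; exact: df].
by apply: dH_ext => q; rewrite big_ord_recl.
Qed.

Lemma dH_comm c V p (f : M -> quat R) X Y : open V ->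
  hwise (smoothR_in c V) f -> V p -> cdom c p ->
  dH c (fun q => dH c f q X) p Y = dH c (fun q => dH c f q Y) p X.
Proof.
move=> oV [f1 f2 f3 f4] Vp cp; apply/quatP; split.
- exact: (dR_comm X Y oV f1 Vp cp).
- exact: (dR_comm X Y oV f2 Vp cp).
- exact: (dR_comm X Y oV f3 Vp cp).
- exact: (dR_comm X Y oV f4 Vp cp).
Qed.

Section DM.
Variables (m n : nat).
Implicit Types F G : M -> 'M[quat R]_(m, n).

Lemma dM_near c p F G X : cdom c p -> (\forall q \near p, F q = G q) ->
  dM c F p X = dM c G p X.
Proof.
move=> cp FG; apply/matrixP => i j; rewrite !mxE; apply: dH_near => //.
by apply: filterS FG => q ->.
Qed.

Lemma mdiff_near c p F G : cdom c p -> (\forall q \near p, F q = G q) ->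
  mdiff c p F -> mdiff c p G.
Proof.
move=> cp FG dF i j; have [f1 f2 f3 f4] := dF i j.
by split; [move: f1|move: f2|move: f3|move: f4]; apply: diffR_near => //;
  apply: filterS FG => q /= ->.
Qed.

Lemma dM_cst c p (A : 'M[quat R]_(m, n)) X : dM c (fun=> A) p X = 0.
Proof. by apply/matrixP => i j; rewrite !mxE dH_cst. Qed.

Lemma dMD c p F G X : mdiff c p F -> mdiff c p G ->
  dM c (fun q => F q + G q) p X = dM c F p X + dM c G p X.
Proof.
move=> dF dG; apply/matrixP => i j; rewrite !mxE -dHD //.
by apply: dH_ext => q; rewrite mxE.
Qed.

Lemma dMN c p F X : mdiff c p F ->
  dM c (fun q => - F q) p X = - dM c F p X.
Proof.
move=> dF; apply/matrixP => i j; rewrite !mxE -dHN //.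
by apply: dH_ext => q; rewrite mxE.
Qed.

Lemma dMB c p F G X : mdiff c p F -> mdiff c p G ->
  dM c (fun q => F q - G q) p X = dM c F p X - dM c G p X.
Proof.
move=> dF dG; rewrite dMD ?dMN //; apply: mwiseN => //; exact: diffR_subalgebra.
Qed.

Lemma dM_lin c p F (a b : R) X Y : mdiff c p F ->
  dM c F p (a *: X + b *: Y) = rsc a (dM c F p X) + rsc b (dM c F p Y).
Proof.
move=> dF; apply/matrixP => i j.
have E Z : dM c F p Z i j = dH c (fun q => F q i j) p Z by rewrite mxE.
by rewrite !rscE E dH_lin // -!E [RHS]mxE; congr (_ + _); rewrite [RHS]mxE.
Qed.

Lemma dM_chart c c' p F X : atlas c -> atlas c' -> cdom c p -> cdom c' p ->
  mdiff c' p F ->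
  mdiff c p F /\
  dM c F p X = dM c' F p ('d (cmap c' \o cinv c) (cmap c p) X).
Proof.
move=> ac ac' cp cp' dF; split=> [i j|].
  have [f1 f2 f3 f4] := dF i j.
  have D f := @dR_chart R M c c' p f X ac ac' cp cp'.
  by split; [exact: (D _ f1).1|exact: (D _ f2).1|exact: (D _ f3).1|exact: (D _ f4).1].
apply/matrixP => i j; rewrite !mxE.
have [f1 f2 f3 f4] := dF i j.
have D f := @dR_chart R M c c' p f X ac ac' cp cp'.
by congr Quat; [exact: (D _ f1).2|exact: (D _ f2).2|exact: (D _ f3).2|exact: (D _ f4).2].
Qed.

Lemma dM_comm c V F p X Y : open V -> smooth_in c V F -> V p -> cdom c p ->
  dM c (fun q => dM c F q X) p Y = dM c (fun q => dM c F q Y) p X.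
Proof.
move=> oV FS Vp cp; apply/matrixP => i j.
have E Z Z' : dM c (fun q => dM c F q Z) p Z' i j =
    dH c (fun q => dH c (fun q' => F q' i j) q Z) p Z'.
  by rewrite mxE; apply: dH_ext => q; rewrite mxE.
apply: etrans (E X Y) (etrans _ (esym (E Y X))); exact: dH_comm oV (FS i j) Vp cp.
Qed.

Lemma smooth_near_neq0 c V F p : open V -> smooth_in c V F -> V p -> cdom c p ->
  F p <> 0 -> \forall q \near p, F q <> 0.
Proof.
move=> oV FS Vp cp F0.
have R0 (f : M -> R) : smoothR_in c V f -> f p != 0 -> \forall q \near p, f q != 0.
  move=> fs fp0; have fc := smoothR_in_continuous oV fs Vp cp.
  exact: cvgr_neq0 fc fp0.
have {F0} [i [j Fij]] : exists i j, F p i j <> 0.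
  apply: contrapT => H; apply: F0; apply/matrixP => i j; rewrite mxE.
  by apply: contrapT => H'; apply: H; exists i, j.
have [f1 f2 f3 f4] := FS i j.
have H (h : quat R -> R) : smoothR_in c V (h \o (fun q => F q i j)) ->
    h 0 = 0 -> h (F p i j) != 0 -> \forall q \near p, F q <> 0.
  move=> hs h0 hp; apply: filterS (R0 _ hs hp) => q /= hq Fq.
  by move: hq; rewrite Fq mxE h0 eqxx.
apply: contrapT => nH; apply: Fij; apply/quatP.
split; apply/eqP; apply: contrapT => /negP h0; apply: nH.
- exact: (H (@qr R)).
- exact: (H (@qi R)).
- exact: (H (@qj R)).
- exact: (H (@qk R)).
Qed.

End DM.

Lemma dMM c p m n k (F : M -> 'M[quat R]_(m, n)) (G : M -> 'M[quat R]_(n, k)) X :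
  cdom c p -> mdiff c p F -> mdiff c p G ->
  dM c (fun q => F q *m G q) p X = dM c F p X *m G p + F p *m dM c G p X.
Proof.
move=> cp dF dG; apply/matrixP => i j; rewrite !mxE.
rewrite (_ : (fun q => _) = fun q => \sum_l F q i l * G q l j); last first.
  by apply/funext => q; rewrite mxE.
rewrite dH_sum; last first.
  by move=> l; apply: hwiseM => //; exact: diffR_subalgebra.
rewrite -big_split /=; apply: eq_bigr => l _; rewrite !mxE.
exact: dHM.
Qed.

Lemma dM_cstM c p m n k (A : 'M[quat R]_(m, n)) (G : M -> 'M[quat R]_(n, k)) X :
  cdom c p -> mdiff c p G -> dM c (fun q => A *m G q) p X = A *m dM c G p X.
Proof.
move=> cp dG; rewrite dMM //; last by apply: mwise_cst; exact: diffR_subalgebra.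
by rewrite dM_cst mul0mx add0r.
Qed.

End Differential.

Section MatrixAlgebra.
Variable R : realType.
Implicit Types x y : quat R.

Lemma qrD x y : qr (x + y) = qr x + qr y. Proof. by []. Qed.
Lemma qiD x y : qi (x + y) = qi x + qi y. Proof. by []. Qed.
Lemma qjD x y : qj (x + y) = qj x + qj y. Proof. by []. Qed.
Lemma qkD x y : qk (x + y) = qk x + qk y. Proof. by []. Qed.
Lemma qrN x : qr (- x) = - qr x. Proof. by []. Qed.
Lemma qiN x : qi (- x) = - qi x. Proof. by []. Qed.
Lemma qjN x : qj (- x) = - qj x. Proof. by []. Qed.
Lemma qkN x : qk (- x) = - qk x. Proof. by []. Qed.
Lemma qr0 : qr (0 : quat R) = 0. Proof. by []. Qed.
Lemma qi0 : qi (0 : quat R) = 0. Proof. by []. Qed.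
Lemma qj0 : qj (0 : quat R) = 0. Proof. by []. Qed.
Lemma qk0 : qk (0 : quat R) = 0. Proof. by []. Qed.

Lemma mxDE m n (A B : 'M[quat R]_(m, n)) i j : (A + B) i j = A i j + B i j.
Proof. by rewrite mxE. Qed.
Lemma mxNE m n (A : 'M[quat R]_(m, n)) i j : (- A) i j = - A i j.
Proof. by rewrite mxE. Qed.
Lemma mx0E m n i j : (0 : 'M[quat R]_(m, n)) i j = 0.
Proof. by rewrite mxE. Qed.

End MatrixAlgebra.

(** Decides identities that hold in every abelian group, treating products as
    atoms, by comparing the real components of the entries. *)
Ltac mx_zmod :=
  let i := fresh "i" in let j := fresh "j" in
  apply/matrixP => i j; rewrite ?(mxDE, mxNE, mx0E); apply/quatP; split;
  [rewrite ?(qrD, qrN, qr0)|rewrite ?(qiD, qiN, qi0)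
  |rewrite ?(qjD, qjN, qj0)|rewrite ?(qkD, qkN, qk0)]; ring.

Section Scalars.
Variable R : realType.

Lemma mulmx_rsc (a : R) m n k (A : 'M[quat R]_(m, n)) (B : 'M[quat R]_(n, k)) :
  A *m rsc a B = rsc a (A *m B).
Proof.
rewrite !rscE; apply/matrixP => i j; rewrite [LHS]mxE [RHS]mxE [in RHS]mxE mulr_sumr.
by apply: eq_bigr => l _; rewrite mxE !mulrA (realqM a).
Qed.

Lemma rsc_mulmx (a : R) m n k (A : 'M[quat R]_(m, n)) (B : 'M[quat R]_(n, k)) :
  rsc a A *m B = rsc a (A *m B).
Proof. by rewrite !rscE scalemxAl. Qed.

Lemma rscD (a : R) m n (A B : 'M[quat R]_(m, n)) :
  rsc a (A + B) = rsc a A + rsc a B.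
Proof. by rewrite !rscE scalerDr. Qed.

Lemma rscN (a : R) m n (A : 'M[quat R]_(m, n)) : rsc a (- A) = - rsc a A.
Proof. by rewrite !rscE scalerN. Qed.

Lemma rsc0 (a : R) m n : rsc a (0 : 'M[quat R]_(m, n)) = 0.
Proof. by rewrite !rscE scaler0. Qed.

Lemma rsc1 m n (A : 'M[quat R]_(m, n)) : rsc 1 A = A.
Proof. by rewrite !rscE scale1r. Qed.

Lemma rsc0l m n (A : 'M[quat R]_(m, n)) : rsc 0 A = 0.
Proof. by rewrite !rscE scale0r. Qed.

Lemma rscDl (a b : R) m n (A : 'M[quat R]_(m, n)) :
  rsc a A + rsc b A = rsc (a + b) A.
Proof.
rewrite !rscE -scalerDl; suff -> : realq a + realq b = realq (a + b) by [].
by rewrite qaddE; apply/quatP; split => /=; ring.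
Qed.

Lemma rscNl (a : R) m n (A : 'M[quat R]_(m, n)) : rsc (- a) A = - rsc a A.
Proof. by apply/eqP; rewrite -addr_eq0 rscDl addNr rsc0l. Qed.

Lemma rscA (a b : R) m n (A : 'M[quat R]_(m, n)) : rsc a (rsc b A) = rsc (a * b) A.
Proof.
rewrite !rscE scalerA; suff -> : realq a * realq b = realq (a * b) by [].
by rewrite qmulE; apply/quatP; split => /=; ring.
Qed.

Lemma rsc_inj (a : R) m n (A B : 'M[quat R]_(m, n)) : a != 0 ->
  rsc a A = rsc a B -> A = B.
Proof.
move=> a0 /(congr1 (rsc a^-1)).
by rewrite !rscA mulVf // !rsc1.
Qed.

Lemma half_double m n (A : 'M[quat R]_(m, n)) : rsc 2^-1 (A + A) = A.
Proof. by rewrite rscD rscDl (_ : 2^-1 + 2^-1 = 1) ?rsc1 //; field. Qed.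

End Scalars.

(** * Affine coordinates of quaternionic line bundles *)

(** A basis of H^2 with its dual basis.  Rows act on the left, where they
    commute with the right scalar multiplication. *)
Record frame (R : realType) := Frame {
  b0 : 'cV[quat R]_2; b1 : 'cV[quat R]_2;
  e0 : 'rV[quat R]_2; e1 : 'rV[quat R]_2;
  e0b0 : e0 *m b0 = 1%:M; e0b1 : e0 *m b1 = 0;
  e1b0 : e1 *m b0 = 0; e1b1 : e1 *m b1 = 1%:M;
  frame_id : b0 *m e0 + b1 *m e1 = 1%:M }.

Section Frames.
Variable R : realType.

(** Every nonzero vector has a nonzero coordinate, so the coordinate frames
    suffice to give every line an affine coordinate. *)
Lemma coord_frame (k k' : 'I_2) : k != k' ->
  {b : frame R | e1 b = delta_mx 0 k'}.
Proof.
move=> kk'.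
have D (i j : 'I_2) : delta_mx 0 i *m delta_mx j 0 = (i == j)%:R%:M :> 'M[quat R]_1.
  rewrite mul_delta_mx_cond; case: (i == j) => /=; last by rewrite mulr0n raddf0.
  by rewrite mulr1n; apply/matrixP => a b; rewrite !mxE !ord1.
unshelve eexists (@Frame R (delta_mx k 0) (delta_mx k' 0) (delta_mx 0 k) (delta_mx 0 k') _ _ _ _ _).
- by rewrite D eqxx.
- by rewrite D (negbTE kk') raddf0.
- by rewrite D eq_sym (negbTE kk') raddf0.
- by rewrite D eqxx.
- rewrite !mul_delta_mx; apply/matrixP => i j; rewrite !mxE.
  case: k k' i j kk' {D} => [[|[|//]] ?] [[|[|//]] ?] [[|[|//]] ?] [[|[|//]] ?] // _;
    by rewrite -!val_eqE /= ?addr0 ?add0r.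
- by [].
Qed.

(** The line with affine coordinate [g] in the frame [b] is spanned by
    [gsec b g] and annihilated by [gann b g]. *)
Definition gsec (b : frame R) (g : 'M[quat R]_1) : 'cV[quat R]_2 :=
  b0 b *m g + b1 b.
Definition gann (b : frame R) (g : 'M[quat R]_1) : 'rV[quat R]_2 :=
  e0 b - g *m e1 b.

Variables (b : frame R) (g : 'M[quat R]_1).

Lemma e1_gsec : e1 b *m gsec b g = 1%:M.
Proof. by rewrite /gsec mulmxDr mulmxA e1b0 mul0mx add0r e1b1. Qed.

Lemma gann_gsec : gann b g *m gsec b g = 0.
Proof.
by rewrite /gann mulmxBl -mulmxA e1_gsec mulmx1 /gsec mulmxDr mulmxA e0b0 mul1mx e0b1 addr0 subrr.
Qed.

Lemma gann_b0 : gann b g *m b0 b = 1%:M.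
Proof. by rewrite /gann mulmxBl -mulmxA e1b0 mulmx0 subr0 e0b0. Qed.

Lemma gann_b0M n (A : 'M_(_, n)) : gann b g *m (b0 b *m A) = A.
Proof. by rewrite mulmxA gann_b0 mul1mx. Qed.

Lemma gann_gsecM n (A : 'M_(_, n)) : gann b g *m (gsec b g *m A) = 0.
Proof. by rewrite mulmxA gann_gsec mul0mx. Qed.

Lemma e1_gsecM n (A : 'M_(_, n)) : e1 b *m (gsec b g *m A) = A.
Proof. by rewrite mulmxA e1_gsec mul1mx. Qed.

Lemma e1_b0M n (A : 'M_(_, n)) : e1 b *m (b0 b *m A) = 0.
Proof. by rewrite mulmxA e1b0 mul0mx. Qed.

(** The decomposition of H^2 into the line and the constant complement spanned
    by [b0 b]. *)
Lemma gauge_id : gsec b g *m e1 b + b0 b *m gann b g = 1%:M.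
Proof.
rewrite /gsec /gann mulmxDl mulmxBr -mulmxA -[RHS](frame_id b).
by mx_zmod.
Qed.

Lemma gauge_dec n (u : 'M[quat R]_(2, n)) :
  u = gsec b g *m (e1 b *m u) + b0 b *m (gann b g *m u).
Proof. by rewrite !mulmxA -mulmxDl gauge_id mul1mx. Qed.

Lemma gauge_decr n (A : 'M[quat R]_(n, 2)) :
  A = A *m gsec b g *m e1 b + A *m b0 b *m gann b g.
Proof. by rewrite -!mulmxA -mulmxDr gauge_id mulmx1. Qed.

End Frames.

Lemma scalar11 (R : realType) m (u : 'M[quat R]_(m, 1)) (a : 'M[quat R]_1) :
  u *m a = u *m (a 0 0)%:M.
Proof. by rewrite {1}[a]mx11_scalar. Qed.

Section Gauges.
Variables (R : realType) (M : riemannSurface R) (L : lineSubbundle M).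
Implicit Types (V : set M) (b : frame R) (g : M -> 'M[quat R]_1).

(** An affine coordinate of the bundle over [V].  Membership in the line becomes
    a linear equation, hence a condition stable under limits. *)
Definition gauge V b g := [/\ open V, smooth V g &
  forall q, V q -> forall u, L q u <-> gann b (g q) *m u = 0].

Lemma gauge_sub V V' b g : open V' -> V' `<=` V -> gauge V b g -> gauge V' b g.
Proof.
move=> oV' VV [_ gs Lg]; split=> // [|q /VV]; last exact: Lg.
exact: smooth_sub gs.
Qed.

Lemma exists_chart (p : M) : exists c : chart R M, atlas c /\ cdom c p.
Proof. by have [c ac cp] := atlas_cover p; exists c. Qed.

Lemma open_neq0 V m n (F : M -> 'M[quat R]_(m, n)) : open V -> smooth V F ->
  open (V `&` [set q | F q <> 0]).
Proof.
move=> oV FS; rewrite openE => p [Vp Fp]; have [c [ac cp]] := exists_chart p.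
have nF := smooth_near_neq0 oV ((smoothP _ _).1 FS c ac) Vp cp Fp.
by apply: filterS2 nF (open_nbhs_nbhs (conj oV Vp)) => q Fq Vq; split.
Qed.

Lemma smooth_cst V m n (A : 'M[quat R]_(m, n)) : open V -> smooth V (fun=> A : 'M_(m, n)).
Proof. by move=> oV; apply: mwise_cst; exact: smoothR_subalgebra. Qed.

Lemma smoothM V m n k (F : M -> 'M[quat R]_(m, n)) (G : M -> 'M[quat R]_(n, k)) :
  open V -> smooth V F -> smooth V G -> smooth V (fun q => F q *m G q).
Proof. by move=> oV; apply: mwiseM; exact: smoothR_subalgebra. Qed.

Lemma smoothD V m n (F G : M -> 'M[quat R]_(m, n)) :
  open V -> smooth V F -> smooth V G -> smooth V (fun q => F q + G q).
Proof. by move=> oV; apply: mwiseD; exact: smoothR_subalgebra. Qed.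

Lemma smoothB V m n (F G : M -> 'M[quat R]_(m, n)) :
  open V -> smooth V F -> smooth V G -> smooth V (fun q => F q - G q).
Proof. by move=> oV; apply: mwiseB; exact: smoothR_subalgebra. Qed.

Lemma smooth_gsec V b g : open V -> smooth V g -> smooth V (fun q => gsec b (g q)).
Proof.
move=> oV gs; apply: smoothD => //; last exact: smooth_cst.
by apply: smoothM => //; exact: smooth_cst.
Qed.

Lemma smooth_gann V b g : open V -> smooth V g -> smooth V (fun q => gann b (g q)).
Proof.
move=> oV gs; apply: smoothB => //; first exact: smooth_cst.
by apply: smoothM => //; exact: smooth_cst.
Qed.

(** Divide a local section by a coordinate that does not vanish at the point. *)
Lemma gauge_exists p : exists V b g, V p /\ gauge V b g.
Proof.
have [V [psi [oV Vp psis Lpsi]]] := fiberP L p.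
have [psi0 _] := Lpsi p Vp.
have [k psik] : exists k, psi p k 0 <> 0.
  apply: contrapT => H; move/eqP: psi0; apply; apply/matrixP => i j; rewrite mxE ord1.
  by apply: contrapT => H'; apply: H; exists i.
have [b be] : exists b : frame R, e1 b = delta_mx 0 k.
  pose k' := rev_ord k.
  have kk' : k' != k by rewrite /k'; case: k {psik k'} => [[|[|//]] ?]; rewrite -val_eqE.
  by have [b be] := @coord_frame R k' k kk'; exists b.
pose a q := e1 b *m psi q.
have a0 : a p <> 0.
  move=> /matrixP/(_ 0 0); rewrite /a be mxE (bigD1 k) //= big1 ?addr0.
    by rewrite !mxE !eqxx mul1r.
  by move=> i ik; rewrite !mxE eqxx (negbTE ik) mul0r.
have as_ : smooth V a by apply: smoothM => //; exact: smooth_cst.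
pose V' := V `&` [set q | a q <> 0].
have oV' : open V' by exact: open_neq0.
have VV : V' `<=` V by move=> q [].
pose g q := e0 b *m psi q *m inv1 (a q).
exists V', b, g; split; first by split.
have psiE q : V' q -> gsec b (g q) *m a q = psi q.
  move=> [_ aq]; rewrite /gsec /g mulmxDl -!mulmxA mulm1Vl // mulmx1.
  by rewrite /a !mulmxA -mulmxDl frame_id mul1mx.
split=> //.
- apply: smoothM => //.
    by apply: smoothM => //; [exact: smooth_cst|exact: smooth_sub psis].
  apply/smoothP => c ac; apply: smooth_in_inv1 => //; first by move=> q [].
  exact: smooth_in_sub VV ((smoothP _ _).1 as_ c ac).
- move=> q V'q u; have [Vq aq] := V'q; have [_ ->] := Lpsi q Vq; split.
    by move=> [s _ <-]; rewrite /rscale mulmxA -psiE // mulmxA gann_gsec !mul0mx.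
  move=> gu; exists ((inv1 (a q) *m (e1 b *m u)) 0 0) => //.
  rewrite /rscale -scalar11 -psiE // -mulmxA [a q *m _]mulmxA mulm1V // mul1mx.
  by rewrite [RHS](gauge_dec b (g q)) gu mulmx0 addr0.
Qed.

Section Fiber.
Variable q : M.
Implicit Types u v : 'cV[quat R]_2.

Lemma fiberB u v : L q u -> L q v -> L q (u - v).
Proof.
have [V [b [g [Vq [_ _ Lg]]]]] := gauge_exists q.
by rewrite !Lg // mulmxBr => -> ->; rewrite subrr.
Qed.

Lemma fiber0 : L q 0.
Proof.
have [V [b [g [Vq [_ _ Lg]]]]] := gauge_exists q.
by rewrite Lg // mulmx0.
Qed.

Lemma fiberN u : L q u -> L q (- u).
Proof. by move=> Lu; rewrite -sub0r; apply: fiberB => //; exact: fiber0. Qed.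

Lemma fiberD u v : L q u -> L q v -> L q (u + v).
Proof. by move=> Lu Lv; rewrite -[v]opprK; apply: fiberB => //; exact: fiberN. Qed.

Lemma fiberM u (a : 'M[quat R]_1) : L q u -> L q (u *m a).
Proof.
have [V [b [g [Vq [_ _ Lg]]]]] := gauge_exists q.
by rewrite !Lg // mulmxA => ->; rewrite mul0mx.
Qed.

Lemma fiberZ u (a : R) : L q u -> L q (rsc a u).
Proof.
have [V [b [g [Vq [_ _ Lg]]]]] := gauge_exists q.
by rewrite !Lg // mulmx_rsc => ->; rewrite rsc0.
Qed.

Lemma proj_eq u v : proj L q u = proj L q v <-> L q (u - v).
Proof.
split=> [|Luv].
  move=> /(congr1 (fun A : set _ => A u)); rewrite /proj /= => <-.
  by rewrite subrr; exact: fiber0.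
apply/seteqP; split=> w; rewrite /proj /= => Lw.
  by rewrite (_ : w - v = (w - u) + (u - v)); [exact: fiberD|mx_zmod].
by rewrite (_ : w - u = (w - v) - (u - v)); [exact: fiberB|mx_zmod].
Qed.

End Fiber.

Lemma gauge_gsec V b g q : gauge V b g -> V q -> L q (gsec b (g q)).
Proof. by move=> [_ _ Lg] Vq; apply/Lg => //; exact: gann_gsec. Qed.

Lemma gauge_fiberE V b g q u : gauge V b g -> V q -> L q u ->
  u = gsec b (g q) *m (e1 b *m u).
Proof.
move=> [_ _ Lg] Vq /(Lg q Vq) u0.
by rewrite [LHS](gauge_dec b (g q)) u0 mulmx0 addr0.
Qed.

Lemma gauge_section V b g : gauge V b g ->
  local_section L V (fun q => gsec b (g q)).
Proof.
move=> G; have [oV gs _] := G; split=> //; first exact: smooth_gsec.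
by move=> q Vq; exact: gauge_gsec G Vq.
Qed.

End Gauges.

(** * The mean curvature sphere in an affine coordinate *)

Section Unit.
Variable R : realType.
Definition ux : R * R := (1, 0).
Definition uy : R * R := rot ux.

Lemma ux_neq0 : ux <> 0.
Proof. by move=> /(congr1 fst) /= /eqP; rewrite oner_eq0. Qed.

Lemma rot_uy : rot uy = - ux. Proof. by []. Qed.

Lemma rot_rot (X : R * R) : rot (rot X) = - X.
Proof. by []. Qed.

Lemma unit_dec (X : R * R) : X = X.1 *: ux + X.2 *: uy.
Proof.
case: X => x y; rewrite /uy /ux /rot; congr pair => /=.
  by rewrite /GRing.scale /= oppr0 mulr0 addr0 mulr1.
by rewrite /GRing.scale /= mulr0 add0r mulr1.
Qed.

Lemma rot_dec (X : R * R) : rot X = (- X.2) *: ux + X.1 *: uy.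
Proof. by rewrite [LHS]unit_dec. Qed.

End Unit.
Arguments ux {R}.
Arguments uy {R}.

(** With [mu] and its derivatives [m1], [m2] along X and JX, this is the only
    off-diagonal entry of the sphere compatible with Q vanishing on the
    line. *)
Definition sphere_beta (R : realType) (mu m1 m2 : 'M[quat R]_1) :=
  rsc 2^-1 (m1 + mu *m m2).

(** The endomorphism mapping psi to psi mu and psi_1 = b0 g1 to
    b0 g2 + psi beta, written with the projections onto the line and its
    complement. *)
Definition sphere_mx (R : realType) (b : frame R) (g g1 g2 mu m1 m2 : 'M[quat R]_1)
    : 'M[quat R]_2 :=
  gsec b g *m mu *m e1 b +
  (b0 b *m g2 + gsec b g *m sphere_beta mu m1 m2) *m inv1 g1 *m gann b g.

(** The derivatives [S1], [S2] of [S] enter through the differentiated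
    equation S psi = psi mu, where [p1] is psi_1 and psi_2 = psi_1 mu.  Applying
    S twice to [p1] shows mu^2 = -1 and that [be] anticommutes with [mu]; then
    Q psi = 0 is a linear equation for [be]. *)
Lemma sphere_determined (R : realType) (S S1 S2 : 'M[quat R]_2) (psi p1 : 'cV[quat R]_2)
    (e r : 'rV[quat R]_2) (g1 mu m1 m2 be : 'M[quat R]_1) :
  S *m S = - 1%:M -> S *m psi = psi *m mu -> S *m p1 = p1 *m mu + psi *m be ->
  e *m psi = 1%:M -> e *m p1 = 0 -> r *m psi = 0 -> r *m p1 = g1 -> g1 <> 0 ->
  S1 *m psi + S *m p1 = p1 *m mu + psi *m m1 ->
  S2 *m psi + S *m (p1 *m mu) = p1 *m mu *m mu + psi *m m2 ->
  S *m S1 *m psi = S2 *m psi ->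
  mu *m mu = - 1%:M /\ be = sphere_beta mu m1 m2.
Proof.
move=> SS Sp Sp1 ep ep1 rp rp1 g0 D1 D2 Q.
have S1p : S1 *m psi = psi *m (m1 - be).
  by rewrite (canRL (addrK _) D1) Sp1 mulmxBr; mx_zmod.
have S2p : S2 *m psi = psi *m (m2 - be *m mu).
  by rewrite (canRL (addrK _) D2) mulmxA Sp1 mulmxDl mulmxBr !mulmxA; mx_zmod.
have ek n (A : 'M[quat R]_(1, n)) : e *m (psi *m A) = A by rewrite mulmxA ep mul1mx.
have eqQ : mu *m (m1 - be) = m2 - be *m mu.
  move: Q; rewrite -mulmxA S1p S2p mulmxA Sp -mulmxA => /(congr1 (mulmx e)).
  by rewrite !ek.
have SSp : p1 *m (mu *m mu) + psi *m (be *m mu + mu *m be) = - p1.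
  have -> : - p1 = S *m (S *m p1) by rewrite mulmxA SS mulNmx mul1mx.
  rewrite {1}Sp1 !mulmxDr !mulmxA Sp Sp1 !mulmxDl.
  by mx_zmod.
have mumu : mu *m mu = - 1%:M.
  move/(congr1 (mulmx r)): SSp.
  rewrite mulmxDr mulmxN !mulmxA rp mul0mx addr0 rp1 => /(congr1 (mulmx (inv1 g1))).
  by rewrite mulmxN !mulmxA mulm1Vl ?mul1mx.
split=> //.
have anti : be *m mu + mu *m be = 0.
  move/(congr1 (mulmx e)): SSp.
  by rewrite mulmxDr ek mulmxN mulmxA ep1 mul0mx add0r oppr0.
rewrite -[LHS]half_double /sphere_beta; congr (rsc _ _).
have -> : m2 = mu *m (m1 - be) + be *m mu by rewrite eqQ subrK.
rewrite mulmxDr !mulmxA mumu mulNmx mul1mx -[mu *m be *m mu]mulmxA.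
have -> : be *m mu = - (mu *m be) by rewrite -[LHS](addrK (mu *m be)) anti add0r.
by rewrite mulmxN mulmxA mumu mulNmx mul1mx; mx_zmod.
Qed.

Section MeanCurvatureSphere.
Variables (R : realType) (M : riemannSurface R).
Implicit Types (V : set M) (b : frame R) (g : M -> 'M[quat R]_1)
  (c : chart R M) (S : M -> 'M[quat R]_2) (L : lineSubbundle M).

Lemma dM_dec c q m n (F : M -> 'M[quat R]_(m, n)) X : mdiff c q F ->
  dM c F q X = rsc X.1 (dM c F q ux) + rsc X.2 (dM c F q uy).
Proof. by move=> dF; rewrite {1}(unit_dec X) dM_lin. Qed.

Lemma dM_rot_dec c q m n (F : M -> 'M[quat R]_(m, n)) X : mdiff c q F ->
  dM c F q (rot X) = rsc X.1 (dM c F q uy) - rsc X.2 (dM c F q ux).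
Proof. by move=> dF; rewrite rot_dec dM_lin // rscNl addrC. Qed.

Lemma dM_opp c q m n (F : M -> 'M[quat R]_(m, n)) X : mdiff c q F ->
  dM c F q (- X) = - dM c F q X.
Proof.
move=> dF; have -> : - X = (- 1) *: X + 0 *: X by rewrite scaleN1r scale0r addr0.
by rewrite dM_lin // rscNl rsc1 rsc0l addr0.
Qed.

Lemma hopfQ_eq0 S c q X n (u : 'M[quat R]_(2, n)) : hopfQ S c q X *m u = 0 <->
  S q *m dM c S q X *m u = dM c S q (rot X) *m u.
Proof.
rewrite /hopfQ /star /quarter -rscE rsc_mulmx mulmxBl; split=> [H|->]; last by rewrite subrr rsc0.
apply/subr0_eq/(@rsc_inj _ 4^-1); last by rewrite rsc0.
by rewrite invr_eq0 pnatr_eq0.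
Qed.

(** The pointwise conditions of a mean curvature sphere on an open set, in all
    charts.  Differentiability in place of smoothness makes them transportable
    between charts, as the comparison of local solutions requires. *)
Record mcs_on L V S : Prop := McsOn {
  mcs_open : open V;
  mcs_sq : forall q, V q -> S q *m S q = - 1%:M;
  mcs_stab : forall q u, V q -> L q u -> L q (S q *m u);
  mcs_diff : forall c q, atlas c -> cdom c q -> V q -> mdiff c q S;
  mcs_dS : forall c q X u, atlas c -> cdom c q -> V q -> L q u ->
    L q (dM c S q X *m u);
  mcs_conf : forall c q X V' psi, atlas c -> cdom c q -> V q -> V' q ->
    local_section L V' psi ->
    L q (dM c psi q (rot X) - dM c (fun q' => S q' *m psi q') q X) /\
    L q (S q *m dM c psi q X - dM c psi q (rot X));
  mcs_Q : forall c q X u, atlas c -> cdom c q -> V q -> L q u ->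
    hopfQ S c q X *m u = 0 }.

Lemma mcs_sqK L V S q m (A : 'M_(_, m)) : mcs_on L V S -> V q ->
  S q *m (S q *m A) = - A.
Proof. by move=> H Vq; rewrite mulmxA (mcs_sq H) // mulNmx mul1mx. Qed.

(** The cosets that define delta are compared through differences of
    representatives. *)
Lemma mcs_onP L S : mean_curvature_sphere L S <-> smooth setT S /\ mcs_on L setT S.
Proof.
split=> [[Ss [SS [SL [dSL [conf QL]]]]]|[Ss H]].
  split=> //; split=> //.
  - exact: openT.
  - by move=> q u _ Lu; rewrite -(SL q); exists u.
  - move=> c q ac cq _; exact: (smooth_in_diff ((smoothP _ _).1 Ss c ac)).
  - by move=> c q X u ac cq _; exact: dSL.
  - move=> c q X V' psi ac cq _ V'q Lpsi.
    have [c1 c2] := conf c q X V' psi ac cq V'q Lpsi; split.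
      exact/proj_eq.
    have : (mulmx (S q) @` delta L c q X psi) (S q *m dM c psi q X).
      exists (dM c psi q X); last by [].
      by rewrite /delta /proj /= subrr; exact: fiber0.
    by rewrite -c2.
  - by move=> c q X u ac cq _; exact: QL.
split; first by [].
split; first by move=> p; exact: (mcs_sq H).
split.
  move=> p; apply/seteqP; split=> [_ [u Lu <-]|u Lu]; first exact: (mcs_stab H).
  exists (- (S p *m u)); first by apply/fiberN/(mcs_stab H).
  by rewrite mulmxN (mcs_sqK _ H) // opprK.
split; first by move=> c p X u ac cp; exact: (mcs_dS H).
split; last by move=> c p X u ac cp; exact: (mcs_Q H).
move=> c p X V psi ac cp Vp Lpsi.
have [c1 c2] := mcs_conf H X ac cp I Vp Lpsi; split; first exact/proj_eq.
rewrite /delta; apply/seteqP; split=> [w|_ [w + <-]]; rewrite /proj /= => Lw.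
  exists (- (S p *m w)); last by rewrite mulmxN (mcs_sqK _ H) // opprK.
  rewrite (_ : _ - _ = - (S p *m (w - dM c psi p (rot X) -
    (S p *m dM c psi p X - dM c psi p (rot X))))).
    by apply/fiberN/(mcs_stab H) => //; exact: fiberB.
  by rewrite !mulmxDr !mulmxN mulmxBr (mcs_sqK _ H) //; mx_zmod.
rewrite (_ : _ - _ = S p *m (w - dM c psi p X) +
    (S p *m dM c psi p X - dM c psi p (rot X))).
  by apply: fiberD => //; apply: (mcs_stab H).
by rewrite mulmxBr; mx_zmod.
Qed.

Lemma dM_gsec b g c q X : cdom c q -> mdiff c q g ->
  dM c (fun q => gsec b (g q)) q X = b0 b *m dM c g q X.
Proof.
move=> cq dg; have sa := diffR_subalgebra c q.
rewrite dMD ?dM_cst ?addr0 ?dM_cstM //; last exact: mwise_cst.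
by apply: mwiseM => //; exact: mwise_cst.
Qed.

Lemma gauge_diff L V b g c q : gauge L V b g -> atlas c -> cdom c q -> V q ->
  mdiff c q g.
Proof. by move=> [_ gs _] ac cq Vq; exact: (smooth_in_diff ((smoothP _ _).1 gs c ac)). Qed.

(** If g_1 vanished at a point, the derivative of every section would stay in
    the line there: a section is psi times a quaternionic function. *)
Lemma immersed_gauge L V b g c q : immersed L -> gauge L V b g -> atlas c ->
  cdom c q -> V q -> dM c g q ux <> 0.
Proof.
move=> imm G ac cq Vq g0; apply: (@ux_neq0 R).
apply: (imm c q ux ac cq) => V' psi V'q [oV' ps Lpsi].
apply/proj_eq; rewrite subr0.
have dg := gauge_diff G ac cq Vq.
have [oV gs Lg] := G.
have sa := diffR_subalgebra c q.
have dpsi := smooth_in_diff ((smoothP _ _).1 ps c ac) V'q cq.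
rewrite (@dM_near _ _ _ _ _ _ _ (fun q => gsec b (g q) *m (e1 b *m psi q)) _ cq).
  rewrite dMM // ?dM_gsec // ?g0 ?mulmx0 ?mul0mx ?add0r.
  - exact/fiberM/(gauge_gsec G).
  - exact: (smooth_in_diff ((smoothP _ _).1 (smooth_gsec b oV gs) c ac)).
  - by apply: mwiseM => //; exact: mwise_cst.
apply: filterS2 (open_nbhs_nbhs (conj oV Vq)) (open_nbhs_nbhs (conj oV' V'q)) => q' Vq' V'q'.
by apply: (gauge_fiberE G) => //; exact: Lpsi.
Qed.

(** The complex structure of the line bundle, read off from psi_2 = psi_1 mu. *)
Definition gmu c g q := inv1 (dM c g q ux) *m dM c g q uy.
Definition gbeta c g q :=
  sphere_beta (gmu c g q) (dM c (gmu c g) q ux) (dM c (gmu c g) q uy).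

Definition gsphere b c g q : 'M[quat R]_2 :=
  sphere_mx b (g q) (dM c g q ux) (dM c g q uy) (gmu c g q)
    (dM c (gmu c g) q ux) (dM c (gmu c g) q uy).

Lemma smooth_gmu c V g : open V -> smooth_in c V g ->
  (forall q, V q -> cdom c q -> dM c g q ux <> 0) -> smooth_in c V (gmu c g).
Proof.
move=> oV gs g1; have sa := @smoothR_in_subalgebra _ _ c _ oV.
by apply: mwiseM => //; [apply: smooth_in_inv1 => //|]; exact: smooth_in_dM.
Qed.

(** A mean curvature sphere is determined by the affine coordinate.  The two
    conditions on delta fix T on the line and modulo the line; Q = 0 on the
    line, together with T^2 = -1, fixes the remaining entry. *)
Lemma mcs_formula L V S c b g q : immersed L -> mcs_on L V S -> gauge L V b g ->
  atlas c -> cdom c q -> V q ->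
  [/\ S q = gsphere b c g q,
      S q *m gsec b (g q) = gsec b (g q) *m gmu c g q,
      S q *m (b0 b *m dM c g q ux) =
        b0 b *m dM c g q uy + gsec b (g q) *m gbeta c g q &
      gmu c g q *m gmu c g q = - 1%:M].
Proof.
move=> imm H G ac cq Vq.
have [oV gs Lg] := G.
pose W := V `&` cdom c.
have oW : open W by apply: openI => //; exact: cdom_open.
have Wq : W q by [].
pose psi q := gsec b (g q).
have psis := smooth_gsec b oV gs.
have g1 q' : W q' -> dM c g q' ux <> 0 by move=> [V' c']; exact: immersed_gauge G ac c' V'.
have gd q' : W q' -> mdiff c q' g by move=> [V' c']; exact: gauge_diff G ac c' V'.
have psid q' : W q' -> mdiff c q' psi.
  by move=> [V' c']; exact: smooth_in_diff ((smoothP _ _).1 psis c ac) V' c'.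
have Sd q' : W q' -> mdiff c q' S by move=> [V' c']; exact: (mcs_diff H).
have [m mdef] : exists m, m = fun q => e1 b *m (S q *m psi q) by eexists.
have Spsi q' : V q' -> S q' *m psi q' = psi q' *m m q'.
  move=> V'; rewrite mdef; apply: (gauge_fiberE G) => //.
  apply: (mcs_stab H) => //; exact: gauge_gsec G V'.
have md q' : W q' -> mdiff c q' m.
  move=> W'; have sa := diffR_subalgebra c q'.
  rewrite mdef; apply: mwiseM => //; first exact: mwise_cst.
  by apply: mwiseM => //; [exact: Sd|exact: psid].
have mE q' : W q' -> m q' = gmu c g q'.
  move=> W'; have [V' c'] := W'.
  have [+ _] := mcs_conf H ux ac c' V' V' (gauge_section G).
  have -> : dM c (fun q => S q *m gsec b (g q)) q' ux =
      dM c (fun q => psi q *m m q) q' ux.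
    by apply: dM_near => //; apply: filterS (open_nbhs_nbhs (conj oV V')) => x; exact: Spsi.
  rewrite dMM //; [|exact: psid|exact: md].
  rewrite !dM_gsec //; [|exact: gd|exact: gd].
  rewrite Lg // mulmxBr mulmxDr -mulmxA !gann_b0M gann_gsecM addr0 => /subr0_eq H2.
  by rewrite /gmu -/uy H2 (mulmxA (inv1 _)) mulm1Vl ?mul1mx //; exact: g1.
have Spsi1 : S q *m psi q = psi q *m gmu c g q by rewrite Spsi // mE.
have mus : smooth_in c W (gmu c g).
  apply: smooth_gmu => //; last by move=> q' W' _; exact: g1.
  by apply: smooth_in_sub ((smoothP _ _).1 gs c ac) => x [].
have mud := smooth_in_diff mus Wq cq.
set mu := gmu c g q in Spsi1 *.
set p1 := b0 b *m dM c g q ux.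
have p2E : b0 b *m dM c g q uy = p1 *m mu.
  by rewrite /p1 /mu /gmu -mulmxA [_ *m (_ *m dM c g q uy)]mulmxA mulm1V ?mul1mx //; exact: g1.
have [be bedef] : exists be, be = e1 b *m (S q *m p1) by eexists.
have Sp1 : S q *m p1 = p1 *m mu + psi q *m be.
  have [_ ] := mcs_conf H ux ac cq Vq Vq (gauge_section G).
  rewrite !dM_gsec //; [|exact: gd|exact: gd].
  rewrite -/p1 -/uy => /Lg => /(_ Vq).
  rewrite mulmxBr gann_b0M => /subr0_eq H2.
  by rewrite [LHS](gauge_dec b (g q)) H2 p2E addrC -bedef.
have ep1 : e1 b *m p1 = 0 by rewrite /p1 mulmxA e1b0 mul0mx.
have epsi : e1 b *m psi q = 1%:M by exact: e1_gsec.
have leib X : dM c S q X *m psi q + S q *m (b0 b *m dM c g q X) =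
    b0 b *m dM c g q X *m mu + psi q *m dM c (gmu c g) q X.
  rewrite -!(@dM_gsec b g c q X cq (gd _ Wq)) -dMM //; [|exact: Sd|exact: psid].
  rewrite /mu -dMM //; last exact: psid.
  apply: dM_near => //; apply: filterS (open_nbhs_nbhs (conj oW Wq)) => x Wx.
  have Vx : V x by case: Wx.
  exact: etrans (Spsi x Vx) (congr1 (mulmx (psi x)) (mE x Wx)).
have Lpsi : L q (psi q) := gauge_gsec G Vq.
have Q1 : S q *m dM c S q ux *m psi q = dM c S q uy *m psi q.
  exact/hopfQ_eq0/(mcs_Q H).
have D2 := leib uy; rewrite p2E in D2.
have [mumu beE] := sphere_determined (mcs_sq H Vq) Spsi1 Sp1 epsi ep1
  (gann_gsec b (g q)) (gann_b0M b (g q) _) (g1 q Wq) (leib ux) D2 Q1.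
have beE' : be = gbeta c g q by [].
split=> //.
- rewrite [S q](gauge_decr b (g q)) /gsphere /sphere_mx -/(gbeta c g q) -beE' p2E -Sp1 -/(psi q) Spsi1.
  congr (_ + _); rewrite /p1 -!mulmxA [dM _ _ _ _ *m (inv1 _ *m _)]mulmxA mulm1V ?mul1mx //.
  exact: g1.
- by rewrite p2E -beE'.
Qed.

End MeanCurvatureSphere.

(** * Locality of the sphere conditions *)

Section Existence.
Variables (R : realType) (M : riemannSurface R).
Implicit Types (V W : set M) (b : frame R) (g : M -> 'M[quat R]_1)
  (c : chart R M) (S : M -> 'M[quat R]_2) (L : lineSubbundle M).

Lemma mcs_on_sub L V W S : open W -> W `<=` V -> mcs_on L V S -> mcs_on L W S.
Proof.
move=> oW WV H; split=> //.
- by move=> q /WV; exact: (mcs_sq H).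
- by move=> q u /WV; exact: (mcs_stab H).
- by move=> c q ac cq /WV; exact: (mcs_diff H).
- by move=> c q X u ac cq /WV; exact: (mcs_dS H).
- by move=> c q X V' psi ac cq /WV; exact: (mcs_conf H).
- by move=> c q X u ac cq /WV; exact: (mcs_Q H).
Qed.

Lemma mcs_on_local L V S : open V ->
  (forall p, V p -> exists W S', [/\ W p, mcs_on L W S' & forall q, W q -> S' q = S q]) ->
  mcs_on L V S.
Proof.
move=> oV loc.
have near_eq W S' q : mcs_on L W S' -> (forall q, W q -> S' q = S q) -> W q ->
    \forall q' \near q, S' q' = S q'.
  move=> H HS Wq; apply: filterS (open_nbhs_nbhs (conj (mcs_open H) Wq)) => x; exact: HS.
have dE W S' c q X : mcs_on L W S' -> (forall q, W q -> S' q = S q) -> W q ->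
    cdom c q -> dM c S' q X = dM c S q X.
  by move=> H HS Wq cq; apply: dM_near => //; exact: near_eq H HS Wq.
split=> //.
- move=> q Vq; have [W [S' [Wq H HS]]] := loc q Vq.
  by rewrite -HS //; exact: (mcs_sq H).
- move=> q u Vq Lu; have [W [S' [Wq H HS]]] := loc q Vq.
  by rewrite -HS //; exact: (mcs_stab H).
- move=> c q ac cq Vq; have [W [S' [Wq H HS]]] := loc q Vq.
  by apply: mdiff_near (near_eq _ _ _ H HS Wq) _ => //; exact: (mcs_diff H).
- move=> c q X u ac cq Vq Lu; have [W [S' [Wq H HS]]] := loc q Vq.
  by rewrite -(dE _ _ _ _ _ H HS) //; exact: (mcs_dS H).
- move=> c q X V' psi ac cq Vq V'q Lpsi; have [W [S' [Wq H HS]]] := loc q Vq.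
  have [c1 c2] := mcs_conf H X ac cq Wq V'q Lpsi.
  have <- : dM c (fun q' => S' q' *m psi q') q X = dM c (fun q' => S q' *m psi q') q X.
    by apply: dM_near => //; apply: filterS (near_eq _ _ _ H HS Wq) => x ->.
  by rewrite -(HS q Wq); split; [exact: c1|exact: c2].
- move=> c q X u ac cq Vq Lu; have [W [S' [Wq H HS]]] := loc q Vq.
  apply/hopfQ_eq0; rewrite -HS // -!(dE _ _ _ _ _ H HS) //.
  by apply/hopfQ_eq0; exact: (mcs_Q H).
Qed.

(** The relation between derivatives along X and JX for one field X implies
    the same relation for all fields, because mu^2 = -1. *)
Lemma conformal_all_directions (r : 'rV[quat R]_2) (S : 'M[quat R]_2) (u : 'cV[quat R]_2)
    (g1 g2 m : 'M[quat R]_1) (x y : R) :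
  g2 = g1 *m m -> m *m m = - 1%:M -> r *m (S *m (u *m g1)) = g2 ->
  (rsc x g1 + rsc y g2) *m m = rsc x g2 - rsc y g1 /\
  r *m (S *m (u *m (rsc x g1 + rsc y g2))) = rsc x g2 - rsc y g1.
Proof.
move=> g2E mm rS.
have g2m : g2 *m m = - g1 by rewrite g2E -mulmxA mm mulmxN mulmx1.
have rS2 : r *m (S *m (u *m g2)) = - g1.
  by rewrite g2E -g2m -rS -!mulmxA.
split; first by rewrite mulmxDl !rsc_mulmx g2m -g2E rscN.
by rewrite !mulmxDr !mulmx_rsc rS rS2 rscN.
Qed.

(** Q(JX) = - S Q(X), so that vanishing for one field X is enough. *)
Lemma hopfQ_all_directions (S S1 S2 : 'M[quat R]_2) (psi : 'cV[quat R]_2) (x y : R) :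
  S *m S = - 1%:M -> S *m S1 *m psi = S2 *m psi ->
  S *m (rsc x S1 + rsc y S2) *m psi = (rsc x S2 - rsc y S1) *m psi.
Proof.
move=> SS Q; rewrite mulmxDr !mulmxDl mulNmx !mulmx_rsc !rsc_mulmx Q; congr (_ + _).
by rewrite -mulmxA -Q !mulmxA SS !mulNmx mul1mx rscN.
Qed.

(** Conditions on one section, along one field and in one chart spread to all
    sections by Leibniz' rule, to all fields by complex linearity, and to all
    charts because the differentials of transition maps commute with J. *)
Lemma mcs_on_intro L W S c b g (m : M -> 'M[quat R]_1) :
  gauge L W b g -> atlas c -> W `<=` cdom c ->
  (forall q, W q -> mdiff c q S) -> (forall q, W q -> mdiff c q m) ->
  (forall q, W q -> S q *m S q = - 1%:M) ->
  (forall q, W q -> S q *m gsec b (g q) = gsec b (g q) *m m q) ->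
  (forall q, W q -> dM c g q uy = dM c g q ux *m m q) ->
  (forall q, W q -> gann b (g q) *m (S q *m (b0 b *m dM c g q ux)) = dM c g q uy) ->
  (forall q, W q -> L q (dM c S q ux *m gsec b (g q))) ->
  (forall q, W q -> S q *m dM c S q ux *m gsec b (g q) = dM c S q uy *m gsec b (g q)) ->
  mcs_on L W S.
Proof.
move=> G ac Wc dS dm SS Spsi g2 Sp1 LS1 Q.
have [oW gs Lg] := G.
have dg q : W q -> mdiff c q g by move=> Wq; apply: gauge_diff G _ _ _ => //; exact: Wc.
have mm q : W q -> m q *m m q = - 1%:M.
  move=> Wq; have /(congr1 (mulmx (e1 b))) : S q *m S q *m gsec b (g q) = gsec b (g q) *m (m q *m m q).
    by rewrite -mulmxA Spsi // !mulmxA Spsi.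
  by rewrite SS // e1_gsecM => <-; rewrite mulNmx mul1mx mulmxN e1_gsec.
have LS q u : W q -> L q u -> L q (S q *m u).
  move=> Wq Lu; rewrite (gauge_fiberE G Wq Lu) mulmxA Spsi //.
  by do 2!apply: fiberM; exact: gauge_gsec G Wq.
have chartE c' q : atlas c' -> cdom c' q -> W q -> exists f : R * R -> R * R,
    (forall X, f (rot X) = rot (f X)) /\
    forall k n (F : M -> 'M[quat R]_(k, n)) X, mdiff c q F ->
      mdiff c' q F /\ dM c' F q X = dM c F q (f X).
  move=> ac' cq' Wq; exists ('d (cmap c \o cinv c') (cmap c' q)).
  have [_ rotd] := atlas_holomorphic ac' ac cq' (Wc _ Wq); split=> // k n F X dF.
  exact: (dM_chart X ac' ac cq' (Wc _ Wq) dF).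
split=> //.
- move=> c' q ac' cq' Wq; have [f [_ fE]] := chartE c' q ac' cq' Wq.
  by have [] := fE _ _ S ux (dS q Wq).
- move=> c' q X u ac' cq' Wq Lu; have [f [_ fE]] := chartE c' q ac' cq' Wq.
  have [_ ->] := fE _ _ S X (dS q Wq).
  rewrite (gauge_fiberE G Wq Lu) mulmxA; apply: fiberM.
  rewrite (dM_dec _ (dS q Wq)) mulmxDl !rsc_mulmx.
  by apply: fiberD; apply: fiberZ; [exact: LS1|rewrite -Q // -mulmxA; exact/LS/LS1].
- move=> c' q X V' chi ac' cq' Wq V'q [oV' chis Lchi].
  have [f [frot fE]] := chartE c' q ac' cq' Wq.
  have sa := diffR_subalgebra c q.
  have cq := Wc _ Wq.
  have dchi : mdiff c q chi := smooth_in_diff ((smoothP _ _).1 chis c ac) V'q cq.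
  have dSchi : mdiff c q (fun q' => S q' *m chi q') by apply: mwiseM => //; exact: dS.
  have [_ ->] := fE _ _ chi X dchi.
  have [_ ->] := fE _ _ chi (rot X) dchi.
  have [_ ->] := fE _ _ _ X dSchi.
  rewrite frot; set Y := f X.
  pose a q := e1 b *m chi q.
  have da : mdiff c q a by apply: mwiseM => //; exact: mwise_cst.
  have dpsi : mdiff c q (fun q => gsec b (g q)).
    exact: (smooth_in_diff ((smoothP _ _).1 (smooth_gsec b oW gs) c ac)).
  have chiE q' : W q' -> V' q' -> chi q' = gsec b (g q') *m a q'.
    by move=> W' V''; apply: (gauge_fiberE G) => //; exact: Lchi.
  have nWV : \forall q' \near q, W q' /\ V' q'.
    exact: filterS2 (open_nbhs_nbhs (conj oW Wq)) (open_nbhs_nbhs (conj oV' V'q)).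
  have dchiE Z : dM c chi q Z = b0 b *m dM c g q Z *m a q + gsec b (g q) *m dM c a q Z.
    rewrite -(dM_gsec b Z cq (dg _ Wq)) -dMM //; apply: dM_near => //.
    by apply: filterS nWV => x [Wx Vx]; exact: chiE.
  (* Any section is psi times a function, and S psi = psi m. *)
  have dSchiE Z : dM c (fun q' => S q' *m chi q') q Z = b0 b *m dM c g q Z *m (m q *m a q) +
      gsec b (g q) *m dM c (fun q => m q *m a q) q Z.
    have dma : mdiff c q (fun q => m q *m a q) by apply: mwiseM => //; exact: dm.
    rewrite -(dM_gsec b Z cq (dg _ Wq)) -dMM //; apply: dM_near => //.
    by apply: filterS nWV => x [Wx Vx]; rewrite chiE // !mulmxA Spsi.
  have [] := conformal_all_directions Y.1 Y.2 (g2 q Wq) (mm q Wq) (Sp1 q Wq).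
  rewrite -dM_dec -?dM_rot_dec; try exact: dg.
  move=> gY SY.
  have SYa : gann b (g q) *m (S q *m (b0 b *m (dM c g q Y *m a q))) = dM c g q (rot Y) *m a q.
    by rewrite -SY !mulmxA.
  split; apply: (Lg q Wq _).2.
    rewrite dchiE dSchiE mulmxBr !mulmxDr -!mulmxA !gann_b0M !gann_gsecM !addr0.
    by rewrite [_ *m (m q *m _)]mulmxA gY subrr.
  rewrite !dchiE mulmxBr !mulmxDr.
  rewrite [S q *m (gsec _ _ *m _)]mulmxA Spsi // -!mulmxA !gann_gsecM !addr0 gann_b0M.
  by rewrite SYa subrr.
- move=> c' q X u ac' cq' Wq Lu; have [f [frot fE]] := chartE c' q ac' cq' Wq.
  apply/hopfQ_eq0.
  have [_ ->] := fE _ _ S X (dS q Wq).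
  have [_ ->] := fE _ _ S (rot X) (dS q Wq).
  rewrite frot; set Y := f X.
  have := hopfQ_all_directions Y.1 Y.2 (SS q Wq) (Q q Wq).
  rewrite -dM_dec -?dM_rot_dec; try exact: dS.
  move=> Qpsi.
  by rewrite (gauge_fiberE G Wq Lu) 2!(mulmxA _ (gsec b (g q))) Qpsi.
Qed.

End Existence.

(** * Existence of the mean curvature sphere *)

Section SphereAlgebra.
Variable R : realType.
Variables (b : frame R) (g g1 g2 mu m1 m2 : 'M[quat R]_1).
Hypotheses (g1n0 : g1 <> 0) (g2E : g2 = g1 *m mu) (mumu : mu *m mu = - 1%:M).
Hypotheses (am1 : m1 *m mu + mu *m m1 = 0) (am2 : m2 *m mu + mu *m m2 = 0).
Variables (be : 'M[quat R]_1) (S : 'M[quat R]_2).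
Hypothesis beE : be = sphere_beta mu m1 m2.
Hypothesis SE : S = sphere_mx b g g1 g2 mu m1 m2.

Lemma gsphere_psi : S *m gsec b g = gsec b g *m mu.
Proof.
by rewrite SE /sphere_mx -beE mulmxDl -[_ *m gann b g *m _]mulmxA gann_gsec mulmx0 addr0 -mulmxA e1_gsec mulmx1.
Qed.

Lemma gsphere_b0g1 : S *m (b0 b *m g1) = b0 b *m g2 + gsec b g *m be.
Proof.
rewrite SE /sphere_mx -beE mulmxDl -[_ *m e1 b *m _]mulmxA e1_b0M mulmx0 add0r.
by rewrite -2!mulmxA gann_b0M mulm1Vl ?mulmx1.
Qed.

(** Differentiating mu^2 = -1 shows that mu anticommutes with its
    derivatives. *)
Lemma gbeta_anti : be *m mu = - (mu *m be).
Proof.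
have a1 : m1 *m mu = - (mu *m m1) by apply/eqP; rewrite -addr_eq0 am1.
have a2 : m2 *m mu = - (mu *m m2) by apply/eqP; rewrite -addr_eq0 am2.
rewrite beE /sphere_beta rsc_mulmx mulmx_rsc -rscN mulmxDl mulmxDr a1 -[mu *m m2 *m mu]mulmxA a2.
by rewrite mulmxN opprD.
Qed.

Lemma gsphere_b0g2 : S *m (b0 b *m g2) = - (b0 b *m g1) - gsec b g *m (mu *m be).
Proof.
rewrite {1}g2E !mulmxA -[S *m _ *m _]mulmxA gsphere_b0g1 mulmxDl g2E.
rewrite -!mulmxA mumu gbeta_anti !mulmxN mulmx1 //.
Qed.

Lemma gsphere_sq : S *m S = - 1%:M.
Proof.
have Sp2 : S *m (S *m gsec b g) = - gsec b g.
  by rewrite gsphere_psi mulmxA gsphere_psi -mulmxA mumu mulmxN mulmx1.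
have Sg2 : S *m (S *m (b0 b *m g1)) = - (b0 b *m g1).
  rewrite gsphere_b0g1 mulmxDr gsphere_b0g2 [S *m (gsec b g *m be)]mulmxA.
  by rewrite gsphere_psi -[_ *m mu *m be]mulmxA subrK.
have Sb2 : S *m (S *m b0 b) = - b0 b.
  have bE : b0 b = b0 b *m g1 *m inv1 g1 by rewrite -mulmxA mulm1V ?mulmx1.
  by rewrite bE (mulmxA S (b0 b *m g1)) (mulmxA S) Sg2 mulNmx.
by rewrite mulmxA in Sp2; rewrite mulmxA in Sb2;
  rewrite [LHS](gauge_decr b g) Sp2 Sb2 !mulNmx -opprD gauge_id.
Qed.

Variables (S1 S2 : 'M[quat R]_2).
Hypothesis D1 : S1 *m gsec b g + S *m (b0 b *m g1) = b0 b *m g1 *m mu + gsec b g *m m1.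
Hypothesis D2 : S2 *m gsec b g + S *m (b0 b *m g2) = b0 b *m g2 *m mu + gsec b g *m m2.

Lemma gsphere_D1 : S1 *m gsec b g = gsec b g *m (m1 - be).
Proof.
rewrite (canRL (addrK _) D1) gsphere_b0g1 g2E mulmxBr !mulmxA.
by move: (_ *m g1 *m mu) (gsec b g *m m1) (gsec b g *m be) => x y z; mx_zmod.
Qed.

(** This is where the choice of beta enters. *)
Lemma gsphere_Q : S *m S1 *m gsec b g = S2 *m gsec b g.
Proof.
rewrite (canRL (addrK _) D2) gsphere_b0g2 -mulmxA gsphere_D1 mulmxA gsphere_psi -mulmxA.
have -> : b0 b *m g2 *m mu = - (b0 b *m g1).
  by rewrite g2E -!mulmxA mumu mulmxN mulmx1 mulmxN.
have -> : mu *m (m1 - be) = m2 + mu *m be.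
  have : be + be = m1 + mu *m m2 by rewrite beE /sphere_beta -rscD half_double.
  move/(congr1 (mulmx mu)); rewrite !mulmxDr [mu *m (mu *m m2)]mulmxA mumu mulNmx mul1mx.
  rewrite mulmxN; move: (mu *m be) (mu *m m1) => x y; clear => xy.
  have -> : y = x + x + m2 by rewrite xy subrK.
  by mx_zmod.
rewrite mulmxDr; move: (b0 b *m g1) (gsec b g *m m2) (gsec b g *m (mu *m be)) => x y z.
by clear; mx_zmod.
Qed.

End SphereAlgebra.

Section GlobalSphere.
Variables (R : realType) (M : riemannSurface R).
Implicit Types (V W : set M) (b : frame R) (g : M -> 'M[quat R]_1)
  (c : chart R M) (S : M -> 'M[quat R]_2).
Variable L : lineSubbundle M.
Hypothesis imm : immersed L.

Lemma smooth_gsphere c V b g : atlas c -> gauge L V b g ->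
  smooth_in c (V `&` cdom c) (gsphere b c g) /\
  smooth_in c (V `&` cdom c) (gmu c g).
Proof.
move=> ac G; have [oV gs Lg] := G.
have oW : open (V `&` cdom c) by apply: openI => //; exact: cdom_open.
have sa := @smoothR_in_subalgebra _ _ c _ oW.
have g1 q : (V `&` cdom c) q -> cdom c q -> dM c g q ux <> 0.
  by move=> [Vq cq] _; exact: immersed_gauge imm G ac cq Vq.
have VW : V `&` cdom c `<=` V by move=> q [].
have gW : smooth_in c (V `&` cdom c) g := smooth_in_sub VW ((smoothP _ _).1 gs c ac).
have psiW : smooth_in c (V `&` cdom c) (fun q => gsec b (g q)).
  exact: smooth_in_sub VW ((smoothP _ _).1 (smooth_gsec b oV gs) c ac).
have annW : smooth_in c (V `&` cdom c) (fun q => gann b (g q)).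
  exact: smooth_in_sub VW ((smoothP _ _).1 (smooth_gann b oV gs) c ac).
have muW : smooth_in c (V `&` cdom c) (gmu c g) by exact: smooth_gmu.
have beW : smooth_in c (V `&` cdom c) (gbeta c g).
  rewrite (_ : gbeta c g = fun q => (realq 2^-1)%:M *m
    (dM c (gmu c g) q ux + gmu c g q *m dM c (gmu c g) q uy)); last first.
    by apply/funext => q; rewrite mul_scalar_mx -rscE.
  apply: mwiseM => //; first exact: mwise_cst.
  apply: (mwiseD sa); first exact: smooth_in_dM.
  by apply: mwiseM => //; exact: smooth_in_dM.
have iW : smooth_in c (V `&` cdom c) (fun q => inv1 (dM c g q ux)).
  by apply: smooth_in_inv1 => //; exact: smooth_in_dM.
split=> //; rewrite /gsphere /sphere_mx.
apply: mwiseD => //.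
  by apply: mwiseM => //; [apply: mwiseM|exact: mwise_cst].
apply: mwiseM => //; apply: mwiseM => //; apply: mwiseD => //; last exact: mwiseM.
by apply: mwiseM => //; [exact: mwise_cst|exact: smooth_in_dM].
Qed.

(** The converse of [mcs_formula]. *)
Lemma gsphere_mcs c V b g : atlas c -> gauge L V b g ->
  (forall q, V q -> cdom c q -> gmu c g q *m gmu c g q = - 1%:M) ->
  mcs_on L (V `&` cdom c) (gsphere b c g).
Proof.
move=> ac G mumu; have [oV gs Lg] := G.
have [SsW musW] := smooth_gsphere ac G.
have oW : open (V `&` cdom c) by apply: openI => //; exact: cdom_open.
have VW : V `&` cdom c `<=` V by move=> q [].
have G' := gauge_sub oW VW G.
have g1 q : (V `&` cdom c) q -> dM c g q ux <> 0.
  by move=> [Vq cq]; exact: immersed_gauge imm G ac cq Vq.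
have g2 q : (V `&` cdom c) q -> dM c g q uy = dM c g q ux *m gmu c g q.
  by move=> Wq; rewrite /gmu mulmxA mulm1V ?mul1mx //; exact: g1.
have mm q : (V `&` cdom c) q -> gmu c g q *m gmu c g q = - 1%:M by move=> [Vq cq]; exact: mumu.
have Sd q : (V `&` cdom c) q -> mdiff c q (gsphere b c g).
  by move=> Wq; have [_ cq] := Wq; exact: (smooth_in_diff SsW Wq cq).
have mud q : (V `&` cdom c) q -> mdiff c q (gmu c g).
  by move=> Wq; have [_ cq] := Wq; exact: (smooth_in_diff musW Wq cq).
have gd q : (V `&` cdom c) q -> mdiff c q g.
  by move=> [Vq cq]; exact: gauge_diff G ac cq Vq.
have psid q : (V `&` cdom c) q -> mdiff c q (fun q => gsec b (g q)).
  by move=> [Vq cq]; exact: (smooth_in_diff ((smoothP _ _).1 (smooth_gsec b oV gs) c ac)).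
have Spsi q : (V `&` cdom c) q ->
    gsphere b c g q *m gsec b (g q) = gsec b (g q) *m gmu c g q.
  by move=> Wq; exact: (gsphere_psi erefl erefl).
have am q X : (V `&` cdom c) q ->
    dM c (gmu c g) q X *m gmu c g q + gmu c g q *m dM c (gmu c g) q X = 0.
  move=> Wq; have [_ cq] := Wq; rewrite -dMM //; [|exact: mud|exact: mud].
  rewrite -(dM_cst c q (- 1%:M : 'M[quat R]_1) X); apply: dM_near => //.
  exact: filterS (open_nbhs_nbhs (conj oW Wq)) => x; exact: mm.
have leib q X : (V `&` cdom c) q -> dM c (gsphere b c g) q X *m gsec b (g q) +
    gsphere b c g q *m (b0 b *m dM c g q X) =
    b0 b *m dM c g q X *m gmu c g q + gsec b (g q) *m dM c (gmu c g) q X.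
  move=> Wq; have [_ cq] := Wq.
  rewrite -(dM_gsec b X cq (gd _ Wq)) -dMM //; [|exact: Sd|exact: psid].
  rewrite -dMM //; [|exact: psid|exact: mud].
  by apply: dM_near => //; apply: filterS (open_nbhs_nbhs (conj oW Wq)) => x; exact: Spsi.
apply: (@mcs_on_intro _ _ _ _ _ c b g (gmu c g)) => //.
- move=> q Wq.
  exact: (gsphere_sq (g1 q Wq) (g2 q Wq) (mm q Wq) (am q _ Wq) (am q _ Wq) erefl erefl).
- move=> q Wq; rewrite (gsphere_b0g1 (g1 q Wq) erefl erefl).
  by rewrite mulmxDr gann_b0M gann_gsecM addr0.
- move=> q Wq.
  rewrite (gsphere_D1 (g1 q Wq) (g2 q Wq) erefl erefl (leib q ux Wq)).
  by apply: fiberM; exact: gauge_gsec G' Wq.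
- move=> q Wq.
  exact: (gsphere_Q (g1 q Wq) (g2 q Wq) (mm q Wq) (am q _ Wq) (am q _ Wq) erefl erefl (leib q ux Wq) (leib q uy Wq)).
Qed.

(** Local solutions agree on overlaps by [mcs_formula]: each of them is a
    mean curvature sphere in all charts, so it is given by the formula in any
    chart and coordinate. *)
Theorem mcs_exists :
  (forall c V b g q, atlas c -> gauge L V b g -> V q -> cdom c q ->
    gmu c g q *m gmu c g q = - 1%:M) ->
  exists S, mean_curvature_sphere L S.
Proof.
move=> conf.
have loc p : exists t : chart R M * set M * frame R * (M -> 'M[quat R]_1),
    [/\ atlas t.1.1.1, cdom t.1.1.1 p, t.1.1.2 p & gauge L t.1.1.2 t.1.2 t.2].
  have [c [ac cp]] := exists_chart p; have [V [b [g [Vp G]]]] := gauge_exists L p.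
  by exists (c, V, b, g).
have [t tP] := choice loc.
pose S p := gsphere (t p).1.2 (t p).1.1.1 (t p).2 p.
have SE c V b g q : atlas c -> gauge L V b g -> V q -> cdom c q ->
    gsphere b c g q = S q.
  move=> ac G Vq cq; have [ac' cq' Vq' G'] := tP q.
  rewrite /S; move: (t q) ac' cq' Vq' G' => [[[c' V'] b'] g'] /= ac' cq' Vq' G'.
  have H := gsphere_mcs ac G (fun q Vq cq => conf c V b g q ac G Vq cq).
  have oW : open ((V `&` cdom c) `&` V').
    by apply: openI; [exact: mcs_open H|case: G'].
  have HW : mcs_on L ((V `&` cdom c) `&` V') (gsphere b c g).
    by apply: mcs_on_sub H => // x [].
  have GW : gauge L ((V `&` cdom c) `&` V') b' g'.
    by apply: gauge_sub G' => // x [].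
  by have [] := mcs_formula imm HW GW ac' cq' (conj (conj Vq cq) Vq').
exists S; apply/mcs_onP; split.
  apply/smoothP => c ac; apply: smooth_in_local => p _ cp.
  have [V [b [g [Vp G]]]] := gauge_exists L p.
  have [SsW _] := smooth_gsphere ac G.
  exists (V `&` cdom c); split; first by split.
  apply: smooth_in_eq SsW; first by apply: openI; [case: G|exact: cdom_open].
  by move=> q [Vq _] cq; exact: (SE c V b g q ac G Vq cq).
apply: (mcs_on_local openT).
move=> p _; have [c [ac cp]] := exists_chart p.
have [V [b [g [Vp G]]]] := gauge_exists L p.
exists (V `&` cdom c), (gsphere b c g); split; first by split.
  exact: gsphere_mcs ac G (fun q Vq cq => conf c V b g q ac G Vq cq).
by move=> q [Vq cq]; exact: (SE c V b g q ac G Vq cq).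
Qed.

End GlobalSphere.

(** * The Hopf fields and their kernels *)

Section HopfAlgebra.
Variables (R : realType) (M : riemannSurface R).
Implicit Types (V W : set M) (b : frame R) (g : M -> 'M[quat R]_1)
  (c : chart R M) (S : M -> 'M[quat R]_2).

Lemma hopfAE S c q X :
  hopfA S c q X = rsc 4^-1 (S q *m dM c S q X + dM c S q (rot X)).
Proof. by rewrite /hopfA /star /quarter -rscE. Qed.

Lemma hopfQE S c q X :
  hopfQ S c q X = rsc 4^-1 (S q *m dM c S q X - dM c S q (rot X)).
Proof. by rewrite /hopfQ /star /quarter -rscE. Qed.

Section Pointwise.
Variables (S : M -> 'M[quat R]_2) (c : chart R M) (q : M).
Hypothesis cq : cdom c q.
Hypothesis (SS : forall q, S q *m S q = - 1%:M).
Hypothesis (Sd : mdiff c q S).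

Lemma dS_anti X : dM c S q X *m S q = - (S q *m dM c S q X).
Proof.
apply/eqP; rewrite -addr_eq0 -dMM //; apply/eqP.
rewrite -(dM_cst c q (- 1%:M : 'M[quat R]_2) X); apply: dM_near => //.
by near=> x; exact: SS.
Unshelve. all: by end_near. Qed.

Lemma hopfA_rot X : hopfA S c q (rot X) = S q *m hopfA S c q X.
Proof.
rewrite !hopfAE rot_rot dM_opp // mulmx_rsc mulmxDr mulmxA SS mulNmx mul1mx addrC.
by [].
Qed.

Lemma hopfQ_rot X : hopfQ S c q (rot X) = - (S q *m hopfQ S c q X).
Proof.
rewrite !hopfQE rot_rot dM_opp // mulmx_rsc -rscN mulmxBr mulmxA SS mulNmx mul1mx.
by rewrite opprK opprB opprK.
Qed.

Lemma hopfA_anti X : S q *m hopfA S c q X = - (hopfA S c q X *m S q).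
Proof.
rewrite !hopfAE mulmx_rsc rsc_mulmx -rscN mulmxDl mulmxDr -mulmxA !dS_anti.
by rewrite mulmxN opprD !opprK.
Qed.

Lemma hopfQ_anti X : S q *m hopfQ S c q X = - (hopfQ S c q X *m S q).
Proof.
rewrite !hopfQE mulmx_rsc rsc_mulmx -rscN mulmxBl mulmxBr -mulmxA !dS_anti.
by rewrite mulmxN opprB opprK addrC.
Qed.

Lemma hopfA_dec X :
  hopfA S c q X = rsc X.1 (hopfA S c q ux) + rsc X.2 (S q *m hopfA S c q ux).
Proof.
rewrite -hopfA_rot !hopfAE (dM_dec X Sd) (dM_rot_dec X Sd) -/uy rot_uy (dM_opp ux Sd).
move: (dM c S q ux) (dM c S q uy) => S1 S2.
rewrite mulmxDr !mulmx_rsc !rscD !rscN !rscA ![_ * 4^-1]mulrC.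
by rewrite -!addrA; congr (_ + _); rewrite addrCA.
Qed.

Lemma hopfQ_dec X :
  hopfQ S c q X = rsc X.1 (hopfQ S c q ux) - rsc X.2 (S q *m hopfQ S c q ux).
Proof.
rewrite -rscN -hopfQ_rot !hopfQE (dM_dec X Sd) (dM_rot_dec X Sd) -/uy rot_uy (dM_opp ux Sd).
move: (dM c S q ux) (dM c S q uy) => S1 S2.
rewrite mulmxDr !mulmx_rsc opprB !rscD !rscN !opprK !rscA ![_ * 4^-1]mulrC.
by mx_zmod.
Qed.

Lemma hopfA_hopfQ X :
  hopfA S c q X = hopfQ S c q X + rsc 2^-1 (dM c S q (rot X)).
Proof.
have -> : 2^-1 = 4^-1 + 4^-1 :> R by field.
by rewrite hopfAE hopfQE -rscDl !rscD rscN addrA subrK.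
Qed.

End Pointwise.

(** A(X) determines A(JX) = S A(X), hence A in all directions and, by the
    holomorphy of transition maps, in all charts. *)
Lemma kerAE S c q u : smooth setT S -> (forall q, S q *m S q = - 1%:M) ->
  atlas c -> cdom c q -> kerA S q u <-> hopfA S c q ux *m u = 0.
Proof.
move=> Ss SS ac cq.
have Sd c' : atlas c' -> cdom c' q -> mdiff c' q S.
  by move=> ac' cq'; exact: smooth_in_diff ((smoothP _ _).1 Ss c' ac') I cq'.
split=> [ku|Au c' X ac' cq']; first exact: ku.
have [_ rotd] := atlas_holomorphic ac' ac cq' cq.
have -> : hopfA S c' q X = hopfA S c q ('d (cmap c \o cinv c') (cmap c' q) X).
  have dE Z := (dM_chart Z ac' ac cq' cq (Sd c ac cq)).2.
  by rewrite !hopfAE !dE rotd.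
rewrite (hopfA_dec SS (Sd c ac cq)) mulmxDl !rsc_mulmx -mulmxA Au.
by rewrite mulmx0 !rsc0 addr0.
Qed.

End HopfAlgebra.

Section BacklundAlgebra.
Variables (R : realType) (psi u : 'cV[quat R]_2) (r : 'rV[quat R]_2).
Hypotheses (rpsi : r *m psi = 0) (ru : r *m u = 1%:M).
(* psi and u = b0 are the section and the constant complement, r annihilates
   psi, and w spans the other line; g11, w1, w2, z1, z2 are derivatives.  In
   the hypothesis on w2 the derivative of g_1 along JX is expressed as that
   of g_2 = g_1 mu along X. *)
Variables (g1 mu m1 m2 z z1 z2 g11 : 'M[quat R]_1).
Variables (S S1 S2 : 'M[quat R]_2).
Hypotheses (g1n0 : g1 <> 0) (mumu : mu *m mu = - 1%:M).
Hypothesis am1 : m1 *m mu + mu *m m1 = 0.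
Hypothesis rSpsi : r *m (S *m psi) = 0.
Hypothesis rSu : r *m (S *m (u *m g1)) = - (g1 *m mu).
Hypothesis SS : S *m S = - 1%:M.
Variables w w1 w2 : 'cV[quat R]_2.
Hypothesis wE : w = u *m g1 + psi *m z.
Hypothesis w1E : w1 = u *m g11 + u *m g1 *m z + psi *m z1.
Hypothesis w2E : w2 = u *m (g11 *m mu + g1 *m m1) + u *m (g1 *m mu) *m z + psi *m z2.
Hypothesis Sw : S *m w = - (w *m mu).
Hypothesis Dw1 : S1 *m w + S *m w1 = - (w1 *m mu + w *m m1).
Hypothesis Dw2 : S2 *m w + S *m w2 = - (w2 *m mu + w *m m2).
Hypothesis Qw : S *m S1 *m w = S2 *m w.

(** For k = w_2 - w_1 mu, the condition Q w = 0 reads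
    S k = - k mu - w (mu_2 + mu mu_1), and the second derivatives of g cancel
    in k, whose component transverse to psi is g_1 (mu_1 + mu z - z mu).
    Comparing transverse components, and using that mu anticommutes with
    mu_1, gives an equation that is linear in mu_1 and mu_2: the claim. *)
Lemma backlund_beta : sphere_beta mu m1 m2 = z *m mu - mu *m z.
Proof.
(* C is the coefficient of k along w. *)
have [C CE] : exists C, C = m1 + mu *m z - z *m mu by eexists.
have [d dE] : exists d, d = z2 - z1 *m mu by eexists.
have kE : w2 - w1 *m mu = u *m (g1 *m C) + psi *m d.
  rewrite w1E w2E CE dE !mulmxDl !mulmxDr !mulmxN !mulmxA.
  move: (u *m g11 *m mu) (u *m g1 *m m1) (u *m g1 *m mu *m z)
    (u *m g1 *m z *m mu) (psi *m z2) (psi *m z1 *m mu) => x1 x2 x3 x4 x5 x6.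
  by clear; mx_zmod.
have Sk : S *m (w2 - w1 *m mu) = - ((w2 - w1 *m mu) *m mu) - w *m (m2 + mu *m m1).
  have SS1 : S *m S1 *m w = - (S *m w1 *m mu) + w *m mu *m m1 + w1.
    rewrite -mulmxA (canRL (addrK _) Dw1) mulmxDr !mulmxN !mulmxDr !mulmxA SS Sw.
    by rewrite !mulNmx mul1mx opprD !opprK.
  move: Qw; rewrite SS1 (canRL (addrK _) Dw2).
  rewrite mulmxBr mulmxA mulmxBl -[w1 *m mu *m mu]mulmxA mumu mulmxN mulmx1 mulmxDr mulmxA.
  move: (S *m w1 *m mu) (w *m mu *m m1) (w2 *m mu) (w *m m2) (S *m w2) => x1 x2 x3 x4 x5.
  move: w1; clear => x6 H.
  have -> : x5 = - (x3 + x4) - (- x1 + x2 + x6) by rewrite H; mx_zmod.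
  by mx_zmod.
have rw : r *m w = g1 by rewrite wE mulmxDr !mulmxA ru rpsi mul1mx mul0mx addr0.
have key : mu *m C = C *m mu + (m2 + mu *m m1).
  have rSk : r *m (S *m (w2 - w1 *m mu)) = - (g1 *m mu *m C).
    have -> : - (g1 *m mu *m C) = r *m (S *m (u *m (g1 *m C))).
      by rewrite (mulmxA u) (mulmxA S) (mulmxA r) rSu mulNmx.
    rewrite kE !mulmxDr -[RHS]addr0; congr (_ + _).
    by rewrite (mulmxA S) (mulmxA r) rSpsi mul0mx.
  have rk : r *m (w2 - w1 *m mu) = g1 *m C.
    by rewrite kE mulmxDr !(mulmxA r) ru rpsi mul1mx mul0mx addr0.
  move/(congr1 (mulmx r)): Sk; rewrite rSk mulmxBr mulmxN !(mulmxA r) rk rw.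
  rewrite -opprD => /oppr_inj H.
  have {H} : g1 *m (mu *m C) = g1 *m (C *m mu + (m2 + mu *m m1)).
    by rewrite mulmxA H mulmxDr mulmxA.
  by move/(congr1 (mulmx (inv1 g1))); rewrite !(mulmxA (inv1 g1)) mulm1Vl // !mul1mx.
have a1 : m1 *m mu = - (mu *m m1) by apply/eqP; rewrite -addr_eq0 am1.
have m2E : m2 = mu *m m1 - (z + z) - (mu *m z *m mu + mu *m z *m mu).
  move: key; rewrite CE !mulmxDl !mulmxDr mulmxN mulNmx !mulmxA mumu a1.
  rewrite -(mulmxA z) mumu !mulNmx mulmxN mul1mx mulmx1.
  move: (mu *m m1) (mu *m z *m mu); move: z m2; clear => x y s t H.
  have -> : y = s + - x - t + s - (t - - x) - s by rewrite H; mx_zmod.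
  by mx_zmod.
rewrite /sphere_beta m2E -[RHS]half_double; congr (rsc _ _).
rewrite !mulmxDr !mulmxN !mulmxDr !mulmxA mumu !mulNmx !mul1mx.
move: (z *m mu) (mu *m z) m1; clear => x y t; mx_zmod.
Qed.

End BacklundAlgebra.

(** * The Baecklund transform is a holomorphic curve *)

Section Backlund.
Variables (R : realType) (M : riemannSurface R).
Implicit Types (V W : set M) (b : frame R) (g : M -> 'M[quat R]_1)
  (c : chart R M).

(** The nonvanishing set of a continuous map is open. *)
Lemma dense_eq0 U c W m n (F : M -> 'M[quat R]_(m, n)) : dense U -> open W ->
  W `<=` cdom c -> smooth_in c W F -> (forall q, U q -> W q -> F q = 0) ->
  forall q, W q -> F q = 0.
Proof.
move=> dU oW Wc Fs F0 q Wq; apply: contrapT => Fq.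
have nF := smooth_near_neq0 oW Fs Wq (Wc q Wq) Fq.
have : nbhs q ([set x | F x <> 0] `&` W).
  by apply: filterS2 nF (open_nbhs_nbhs (conj oW Wq)) => x.
rewrite nbhsE; case=> O [oO Oq] OF.
have [x [Ox Ux]] := dU O (ex_intro _ q Oq) oO.
by have [Fx Wx] := OF x Ox; apply: Fx; exact: F0.
Qed.

Lemma smooth_hopfA c S X : smooth_in c setT S -> smooth_in c setT (fun q => hopfA S c q X).
Proof.
move=> Ss; have sa := @smoothR_in_subalgebra _ _ c _ (@openT M).
rewrite (_ : (fun q => _) = fun q => (realq 4^-1)%:M *m
    (S q *m dM c S q X + dM c S q (rot X))); last first.
  by apply/funext => q; rewrite mul_scalar_mx -rscE hopfAE.
have dS Z := smooth_in_dM Z (@openT M) Ss.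
apply: (mwiseM sa); first exact: (mwise_cst sa).
by apply: (mwiseD sa); [apply: (mwiseM sa)|]; [exact: Ss|exact: dS|exact: dS].
Qed.

Lemma smooth_hopfQ c S X : smooth_in c setT S -> smooth_in c setT (fun q => hopfQ S c q X).
Proof.
move=> Ss; have sa := @smoothR_in_subalgebra _ _ c _ (@openT M).
rewrite (_ : (fun q => _) = fun q => (realq 4^-1)%:M *m
    (S q *m dM c S q X - dM c S q (rot X))); last first.
  by apply/funext => q; rewrite mul_scalar_mx -rscE hopfQE.
have dS Z := smooth_in_dM Z (@openT M) Ss.
apply: (mwiseM sa); first exact: (mwise_cst sa).
by apply: (mwiseB sa); [apply: (mwiseM sa)|]; [exact: Ss|exact: dS|exact: dS].
Qed.

Variables (L Lt : lineSubbundle M) (S : M -> 'M[quat R]_2) (U : set M).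
Hypotheses (Ss : smooth setT S) (HS : mcs_on L setT S).
Hypothesis Wil : closed_form1 (star (hopfA S)).
Hypotheses (oU : open U) (dU : dense U) (ker : forall p, U p -> Lt p = kerA S p).
Hypothesis imm : immersed Lt.

Let SS q : S q *m S q = - 1%:M. Proof. exact: (mcs_sq HS). Qed.
Let Sc c : atlas c -> smooth_in c setT S. Proof. exact: (smoothP _ _).1. Qed.
Let Sd c q : atlas c -> cdom c q -> mdiff c q S.
Proof. by move=> ac cq; exact: (smooth_in_diff (Sc ac) I cq). Qed.

Lemma ker_hopfA c q u : atlas c -> cdom c q -> U q ->
  Lt q u <-> hopfA S c q ux *m u = 0.
Proof. by move=> ac cq Uq; rewrite ker //; exact: kerAE. Qed.

Lemma ker_hopfA_all c q u X : atlas c -> cdom c q -> U q -> Lt q u ->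
  hopfA S c q X *m u = 0.
Proof. by move=> ac cq Uq; rewrite ker //; apply. Qed.

Section InGauge.
Variables (c : chart R M) (V : set M) (b : frame R) (g : M -> 'M[quat R]_1).
Hypotheses (ac : atlas c) (G : gauge Lt V b g).
Let W := V `&` cdom c.
Let oW : open W. Proof. by apply: openI; [case: G|exact: cdom_open]. Qed.
Let WV : W `<=` V. Proof. by move=> q []. Qed.
Let Wc : W `<=` cdom c. Proof. by move=> q []. Qed.
Let GW : gauge Lt W b g := gauge_sub oW WV G.
Let gW : smooth_in c W g.
Proof. by have [_ gs _] := GW; exact: (smoothP _ _).1. Qed.
Let psiW : smooth_in c W (fun q => gsec b (g q)).
Proof. by have [oW' gs _] := GW; exact: ((smoothP _ _).1 (smooth_gsec b oW' gs)). Qed.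
Let annW : smooth_in c W (fun q => gann b (g q)).
Proof. by have [oW' gs _] := GW; exact: ((smoothP _ _).1 (smooth_gann b oW' gs)). Qed.
Let SW : smooth_in c W S.
Proof. exact: (smooth_in_sub (@subsetT _ W) (Sc ac)). Qed.

(** Lt is S-stable: where Lt = ker A because S A = - A S, elsewhere by
    continuity. *)
Lemma backlund_stable q : V q -> cdom c q ->
  gann b (g q) *m (S q *m gsec b (g q)) = 0.
Proof.
move=> Vq cq; have sa := @smoothR_in_subalgebra _ _ c _ oW.
apply: (@dense_eq0 U c W _ _ (fun q => gann b (g q) *m (S q *m gsec b (g q))) dU oW Wc).
- by apply: (mwiseM sa); [exact: annW|apply: (mwiseM sa); [exact: SW|exact: psiW]].
- move=> x Ux Wx; have [_ _ Lg] := GW; have cx := Wc Wx.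
  apply: (Lg x Wx _).1; apply: (ker_hopfA _ ac cx Ux).2.
  rewrite mulmxA -[hopfA _ _ _ _ *m S x]opprK -(hopfA_anti cx SS (Sd ac cx)).
  rewrite mulNmx -mulmxA (ker_hopfA _ ac cx Ux).1 ?mulmx0 ?oppr0 //.
  exact: gauge_gsec GW Wx.
- by split.
Qed.

(** The Willmore equation d*A = 0 applied to psi, which A annihilates, gives
    A_1 (psi_1 - S psi_2) = 0. *)
Lemma backlund_conf q : V q -> cdom c q ->
  gann b (g q) *m (S q *m (b0 b *m dM c g q ux)) = - dM c g q uy.
Proof.
move=> Vq cq; have sa := @smoothR_in_subalgebra _ _ c _ oW.
apply/eqP; rewrite -addr_eq0; apply/eqP.
have dgW X := smooth_in_dM X oW gW.
apply: (@dense_eq0 U c W _ _ (fun q => gann b (g q) *m (S q *m (b0 b *m dM c g q ux))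
  + dM c g q uy) dU oW Wc).
- apply: (mwiseD sa); last exact: dgW.
  apply: (mwiseM sa); first exact: annW.
  apply: (mwiseM sa); first exact: SW.
  by apply: (mwiseM sa); [exact: (mwise_cst sa)|exact: dgW].
- move=> x Ux Wx; have [_ gs Lg] := GW; have cx := Wc Wx.
  have dg : mdiff c x g := gauge_diff G ac cx (WV Wx).
  have dA X : mdiff c x (fun q => hopfA S c q X).
    exact: (smooth_in_diff (smooth_hopfA X (Sc ac)) I cx).
  have dpsi : mdiff c x (fun q => gsec b (g q)) := smooth_in_diff psiW Wx cx.
  have DA X Y : dM c (fun q => hopfA S c q X) x Y *m gsec b (g x) +
      hopfA S c x X *m (b0 b *m dM c g x Y) = 0.
    rewrite -(dM_gsec b Y cx dg) -dMM; [|by []|exact: dA|by []].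
    rewrite -(dM_cst c x 0 Y); apply: dM_near => //.
    have nUW : \forall y \near x, U y /\ W y.
      exact: filterS2 (open_nbhs_nbhs (conj oU Ux)) (open_nbhs_nbhs (conj oW Wx)).
    apply: filterS nUW => y [Uy Wy].
    by apply: (ker_hopfA_all _ ac (Wc Wy) Uy); exact: gauge_gsec GW Wy.
  have closed : dM c (fun q => hopfA S c q ux) x ux + dM c (fun q => hopfA S c q uy) x uy = 0.
    have e2 : dM c (fun q => star (hopfA S) c q uy) x ux =
        - dM c (fun q => hopfA S c q ux) x ux.
      rewrite -dMN; last exact: dA.
      apply: dM_near => //; apply: filterS (near_cdom cx) => y cy.
      rewrite /star rot_uy !hopfAE dM_opp; last exact: Sd.
      rewrite -/uy (_ : rot (- ux) = - uy); last by rewrite -rot_uy rot_rot.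
      by rewrite dM_opp; [rewrite mulmxN -opprD rscN|exact: Sd].
    have conclude (P Q P' : 'M[quat R]_2) : P - Q = 0 -> P = - P' -> P' + Q = 0.
      by move=> + PE; rewrite PE -opprD => /eqP; rewrite oppr_eq0 => /eqP.
    exact: (conclude _ _ _ (Wil ux uy ac cx) e2).
  have sum : hopfA S c x ux *m (b0 b *m dM c g x ux) +
      hopfA S c x uy *m (b0 b *m dM c g x uy) = 0.
    have conclude (P Q : 'M[quat R]_2) (p s t : 'cV[quat R]_2) : P + Q = 0 ->
        P *m p + s = 0 -> Q *m p + t = 0 -> s + t = 0.
      move=> PQ Ps Qt; have : (P + Q) *m p + (s + t) = 0.
        by rewrite mulmxDl addrACA Ps Qt addr0.
      by rewrite PQ mul0mx add0r.
    exact: conclude closed (DA ux ux) (DA uy uy).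
  have inL : Lt x (b0 b *m dM c g x ux - S x *m (b0 b *m dM c g x uy)).
    have conclude (A1 A2 T : 'M[quat R]_2) (p1 p2 : 'cV[quat R]_2) : A2 = T *m A1 ->
        T *m A1 = - (A1 *m T) -> A1 *m p1 + A2 *m p2 = 0 -> A1 *m (p1 - T *m p2) = 0.
      by move=> -> -> <-; rewrite mulmxBr mulNmx mulmxA.
    apply: (ker_hopfA _ ac cx Ux).2.
    exact: conclude (hopfA_rot SS (Sd ac cx) ux) (hopfA_anti cx SS (Sd ac cx) ux) sum.
  have LS : Lt x (S x *m (b0 b *m dM c g x ux - S x *m (b0 b *m dM c g x uy))).
    rewrite (gauge_fiberE GW Wx inL) mulmxA; apply: fiberM; apply: (Lg x Wx _).2.
    by apply: backlund_stable; [exact: WV|].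
  have conclude (r : 'rV[quat R]_2) (T : 'M[quat R]_2) (p1 p2 : 'cV[quat R]_2) :
      T *m T = - 1%:M -> r *m (T *m (p1 - T *m p2)) = 0 -> r *m (T *m p1) + r *m p2 = 0.
    move=> TT; rewrite mulmxBr (mulmxA T T) TT mulNmx mul1mx opprK.
    by rewrite mulmxDr.
  have := conclude _ _ _ _ (SS x) ((Lg x Wx _).1 LS).
  by rewrite gann_b0M.
- by split.
Qed.

(** g_2 = N g_1 for N = - rho S b0, and N^2 = -1 because S^2 = -1 and
    rho S psi = 0. *)
Lemma backlund_mu q : V q -> cdom c q ->
  gmu c g q *m gmu c g q = - 1%:M.
Proof.
move=> Vq cq.
have g1 := immersed_gauge imm G ac cq Vq.
have H1 := backlund_stable Vq cq; have H2 := backlund_conf Vq cq.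
set g1' := dM c g q ux in g1 H2; set g2' := dM c g q uy in H2.
pose N := - (gann b (g q) *m S q *m b0 b).
have NE : g2' = N *m g1' by rewrite /N mulNmx -!mulmxA H2 opprK.
have NN : N *m N = - 1%:M.
  have square (r e : 'rV[quat R]_2) (u psi : 'cV[quat R]_2) (T : 'M[quat R]_2) :
      psi *m e + u *m r = 1%:M -> T *m T = - 1%:M -> r *m u = 1%:M ->
      r *m (T *m psi) = 0 -> - (r *m T *m u) *m - (r *m T *m u) = - 1%:M.
    move=> id1 TT ru rTpsi; rewrite mulNmx mulmxN opprK.
    have -> : r *m T *m u *m (r *m T *m u) = r *m T *m (u *m r) *m T *m u.
      by rewrite !mulmxA.
    have -> : u *m r = 1%:M - psi *m e by rewrite -id1 addrAC subrr add0r.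
    have t1 : r *m T *m T *m u = - 1%:M.
      by rewrite -(mulmxA r T T) TT mulmxN mulmx1 mulNmx ru.
    have t2 : r *m T *m (psi *m e) *m T *m u = 0.
      by rewrite (mulmxA _ psi e) -(mulmxA r T psi) rTpsi !mul0mx.
    by rewrite mulmxBr mulmx1 !mulmxBl t1 t2 subr0.
  exact: square (gauge_id b (g q)) (SS q) (gann_b0 b (g q)) H1.
rewrite /gmu -/g1' -/g2' NE -!mulmxA (mulmxA g1') mulm1V // mul1mx (mulmxA N) NN.
by rewrite mulNmx mul1mx mulmxN mulm1Vl.
Qed.

End InGauge.

Lemma backlund_mcs : exists St, mean_curvature_sphere Lt St.
Proof.
by apply: (mcs_exists imm) => c V b g q ac G Vq cq; exact: (backlund_mu ac G Vq cq).
Qed.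

End Backlund.

(** * The two Hopf fields agree where the lines differ *)

Section FinalAlgebra.
Variable R : realType.

(** The line spanned by [w] is S-stable and T = - S on it.  By the tangency
    conditions dS preserves this line and w_2 = S w_1 modulo it; then S + T
    vanishes on the line and (S + T) S = T (S + T), so that all terms
    containing w_1 cancel. *)
Lemma hopf_fields_agree (S T S1 S2 T1 T2 : 'M[quat R]_2) (w w1 w2 : 'cV[quat R]_2)
    (mu m1 m2 t s : 'M[quat R]_1) :
  S *m S = - 1%:M -> T *m T = - 1%:M ->
  S *m w = - (w *m mu) -> T *m w = w *m mu ->
  S1 *m w + S *m w1 = - (w1 *m mu + w *m m1) ->
  S2 *m w + S *m w2 = - (w2 *m mu + w *m m2) ->
  T1 *m w + T *m w1 = w1 *m mu + w *m m1 ->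
  T2 *m w + T *m w2 = w2 *m mu + w *m m2 ->
  S1 *m w = w *m t -> w2 = S *m w1 + w *m s ->
  (T *m T1 - T2) *m w = (S *m S1 + S2) *m w.
Proof.
move=> SS TT Sw Tw DS1 DS2 DT1 DT2 S1w w2E.
have T1w : T1 *m w = - (S1 *m w) - (S *m w1 + T *m w1).
  rewrite (canRL (addrK _) DT1) -[w1 *m mu + _]opprK -DS1.
  move: (S1 *m w) (S *m w1) (T *m w1); clear => x y z; mx_zmod.
have T2w : T2 *m w = - (S2 *m w) - (S *m w2 + T *m w2).
  rewrite (canRL (addrK _) DT2) -[w2 *m mu + _]opprK -DS2.
  move: (S2 *m w) (S *m w2) (T *m w2); clear => x y z; mx_zmod.
have STw2 : S *m w2 + T *m w2 = - w1 + T *m S *m w1.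
  rewrite w2E !mulmxDr !mulmxA SS mulNmx mul1mx Sw Tw mulNmx.
  move: (w *m mu *m s) (T *m S *m w1) => x y; mx_zmod.
rewrite mulmxBl mulmxDl T2w STw2 -!mulmxA T1w S1w mulmxBr mulmxN mulmxDr !mulmxA.
rewrite TT Sw Tw !mulNmx mul1mx.
move: (w *m mu *m t) (T *m S *m w1) (S2 *m w) => x y z; mx_zmod.
Qed.

(** With this value of beta the vector transverse to psi is an eigenvector of
    the sphere. *)
Lemma sphere_on_transverse (T : 'M[quat R]_2) (psi u : 'cV[quat R]_2)
    (g1 g2 mu z be : 'M[quat R]_1) :
  T *m psi = psi *m mu -> T *m (u *m g1) = u *m g2 + psi *m be ->
  g2 = g1 *m mu -> be = z *m mu - mu *m z ->
  T *m (u *m g1 + psi *m z) = (u *m g1 + psi *m z) *m mu.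
Proof.
move=> Tpsi Tu g2E beE; rewrite mulmxDr Tu (mulmxA T) Tpsi g2E beE.
rewrite mulmxDl mulmxBr !mulmxA.
move: (u *m g1 *m mu) (psi *m z *m mu) (psi *m mu *m z) => x1 x2 x3; mx_zmod.
Qed.

Lemma eq_on_frame n (b : frame R) (g g1 z : 'M[quat R]_1) (w : 'cV[quat R]_2)
    (A B : 'M[quat R]_(n, 2)) :
  g1 <> 0 -> w = b0 b *m g1 + gsec b g *m z ->
  A *m gsec b g = B *m gsec b g -> A *m w = B *m w -> A = B.
Proof.
move=> g1n0 wE Apsi Aw.
have bE : b0 b = (w - gsec b g *m z) *m inv1 g1.
  by rewrite wE addrK -mulmxA mulm1V ?mulmx1.
have Ab : A *m b0 b = B *m b0 b.
  rewrite bE !(mulmxA _ (_ - _)) !mulmxBr Aw !(mulmxA _ (gsec b g)) Apsi.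
  by [].
by rewrite [A](gauge_decr b g) [B](gauge_decr b g) Apsi Ab.
Qed.

End FinalAlgebra.

Section Transform.
Variables (R : realType) (M : riemannSurface R).
Variables (L Lt : lineSubbundle M) (S : M -> 'M[quat R]_2) (U : set M).
Hypotheses (Ss : smooth setT S) (HS : mcs_on L setT S).
Hypothesis Wil : closed_form1 (star (hopfA S)).
Hypotheses (oU : open U) (dU : dense U) (ker : forall p, U p -> Lt p = kerA S p).
Hypothesis imm : immersed Lt.
Variable St : M -> 'M[quat R]_2.
Hypotheses (Sts : smooth setT St) (HSt : mcs_on Lt setT St).

Section AtPoint.
Variables (c : chart R M) (q : M) (u : 'cV[quat R]_2).
Hypotheses (ac : atlas c) (cq : cdom c q) (Uq : U q).
Hypotheses (Lu : L q u) (nLu : ~ Lt q u).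

(** At a point of U where the line L, spanned there by [u], is different from
    Lt, the section w is defined near the point and all identities hold on a
    neighbourhood, so they may be differentiated. *)
Lemma hopfQ_backlund_at X : hopfQ St c q X = hopfA S c q X.
Proof.
have SS x : S x *m S x = - 1%:M by exact: (mcs_sq HS).
have TT x : St x *m St x = - 1%:M by exact: (mcs_sq HSt).
have [V [b [g [Vq G]]]] := gauge_exists Lt q.
have [V1 [b' [h [V1q G1]]]] := gauge_exists L q.
have [oV gs Lg] := G; have [oV1 hs Lh] := G1.
pose phi x := gsec b' (h x).
have [y ydef] : exists y, y = fun x => gann b (g x) *m phi x by eexists.
have yq : y q <> 0.
  move=> y0; apply: nLu; apply: (Lg q Vq _).2.
  rewrite ydef in y0.
  by rewrite (gauge_fiberE G1 V1q Lu) mulmxA -/(phi q) y0 mul0mx.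
have oVV : open (V `&` V1) by exact: openI.
have annVV : smooth (V `&` V1) (fun x => gann b (g x)).
  by apply: smooth_sub (smooth_gann b oV gs) => x [].
have phiVV : smooth (V `&` V1) phi.
  by apply: smooth_sub (smooth_gsec b' oV1 hs) => x [].
have yVV : smooth (V `&` V1) y by rewrite ydef; exact: smoothM oVV annVV phiVV.
pose W := ((V `&` V1) `&` [set x | y x <> 0]) `&` cdom c.
have oW : open W by apply: openI; [exact: open_neq0|exact: cdom_open].
have WV x : W x -> V x by move=> [[[]]].
have WV1 x : W x -> V1 x by move=> [[[]]].
have Wc x : W x -> cdom c x by move=> [].
have Wy x : W x -> y x <> 0 by move=> [[]].
have WVV : W `<=` V `&` V1 by move=> x [[]].
have Wq : W q by split=> //; split.
have sa := @smoothR_in_subalgebra _ _ c _ oW.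
have gW : smooth_in c W g := smooth_in_sub WV ((smoothP _ _).1 gs c ac).
have psiW : smooth_in c W (fun x => gsec b (g x)) :=
  smooth_in_sub WV ((smoothP _ _).1 (smooth_gsec b oV gs) c ac).
have phiW : smooth_in c W phi := smooth_in_sub WVV ((smoothP _ _).1 phiVV c ac).
have yW : smooth_in c W y := smooth_in_sub WVV ((smoothP _ _).1 yVV c ac).
have SW : smooth_in c W S := smooth_in_sub (@subsetT _ W) ((smoothP _ _).1 Ss c ac).
have StW : smooth_in c W St := smooth_in_sub (@subsetT _ W) ((smoothP _ _).1 Sts c ac).
have g1n0 x : W x -> dM c g x ux <> 0.
  by move=> Wx; exact: (immersed_gauge imm G ac (Wc x Wx) (WV x Wx)).
have dgW X' : smooth_in c W (fun x => dM c g x X') by exact: smooth_in_dM.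
have iyW : smooth_in c W (fun x => inv1 (y x)).
  by apply: (smooth_in_inv1 oW _ yW) => x Wx _; exact: Wy.
have muW : smooth_in c W (gmu c g).
  by apply: smooth_gmu => // x Wx _; exact: g1n0.
(* Normalizes the section phi of L so that w has the form psi_1 + psi z. *)
have [s sE] : exists s, s = fun x => inv1 (y x) *m dM c g x ux by eexists.
have sW : smooth_in c W s by rewrite sE; apply: (mwiseM sa); [exact: iyW|exact: dgW].
have [w wdef] : exists w, w = fun x => phi x *m s x by eexists.
have wW : smooth_in c W w by rewrite wdef; exact: (mwiseM sa phiW sW).
have [z zdef] : exists z, z = fun x => e1 b *m w x by eexists.
have zW : smooth_in c W z.
  by rewrite zdef; apply: (mwiseM sa) wW; exact: (mwise_cst sa).
have rw x : W x -> gann b (g x) *m w x = dM c g x ux.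
  move=> Wx; have -> : w x = phi x *m (inv1 (y x) *m dM c g x ux) by rewrite wdef sE.
  rewrite mulmxA (_ : _ *m phi x = y x); last by rewrite ydef.
  by rewrite mulmxA mulm1V ?mul1mx; last exact: Wy.
have wE x : W x -> w x = b0 b *m dM c g x ux + gsec b (g x) *m z x.
  by move=> Wx; rewrite zdef [LHS](gauge_dec b (g x)) (rw x Wx) addrC.
have Lphi x : W x -> L x (phi x) by move=> Wx; exact: gauge_gsec G1 (WV1 x Wx).
have Lw x : W x -> L x (w x) by move=> Wx; rewrite wdef; apply: fiberM; exact: Lphi.
have Lspan x v : W x -> L x v ->
    v = w x *m (inv1 (dM c g x ux) *m (gann b (g x) *m v)).
  move=> Wx Lv; have vE := gauge_fiberE G1 (WV1 x Wx) Lv; rewrite -/(phi x) in vE.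
  set a := e1 b' *m v in vE.
  have -> : gann b (g x) *m v = y x *m a by rewrite vE mulmxA ydef.
  have g1V := mulm1V (g1n0 x Wx); have yV := mulm1Vl (Wy x Wx).
  have -> : w x = phi x *m (inv1 (y x) *m dM c g x ux) by rewrite wdef sE.
  move: (dM c g x ux) g1V => g1 g1V.
  by rewrite {1}vE -!mulmxA (mulmxA g1) g1V mul1mx (mulmxA (inv1 _)) yV mul1mx.
have rSpsi x : W x -> gann b (g x) *m (S x *m gsec b (g x)) = 0.
  move=> Wx; exact: (backlund_stable Ss HS dU ker ac G (WV x Wx) (Wc x Wx)).
have g2E x : W x -> dM c g x uy = dM c g x ux *m gmu c g x.
  by move=> Wx; rewrite /gmu mulmxA mulm1V ?mul1mx //; exact: g1n0.
have rSb x : W x -> gann b (g x) *m (S x *m (b0 b *m dM c g x ux)) =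
    - (dM c g x ux *m gmu c g x).
  move=> Wx; rewrite -g2E //.
  exact: (backlund_conf Ss HS Wil oU dU ker ac G (WV x Wx) (Wc x Wx)).
have Sw x : W x -> S x *m w x = - (w x *m gmu c g x).
  move=> Wx; have LSw := mcs_stab HS I (Lw x Wx).
  rewrite [LHS](Lspan x _ Wx LSw).
  have -> : gann b (g x) *m (S x *m w x) = - (dM c g x ux *m gmu c g x).
    rewrite wE // !mulmxDr rSb // (mulmxA (S x)) (mulmxA (gann _ _)) rSpsi //.
    by rewrite mul0mx addr0.
  by rewrite !mulmxN (mulmxA (inv1 _)) mulm1Vl ?mul1mx //; exact: g1n0.
have diff x m n (F : M -> 'M_(m, n)) : smooth_in c W F -> W x -> mdiff c x F.
  by move=> FW Wx; exact: smooth_in_diff FW Wx (Wc x Wx).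
have mumu x : W x -> gmu c g x *m gmu c g x = - 1%:M.
  move=> Wx; exact: (backlund_mu Ss HS Wil oU dU ker imm ac G (WV x Wx) (Wc x Wx)).
have nW x : W x -> \forall x' \near x, W x'.
  by move=> Wx; exact: open_nbhs_nbhs.
have am x X' : W x ->
    dM c (gmu c g) x X' *m gmu c g x + gmu c g x *m dM c (gmu c g) x X' = 0.
  move=> Wx; have dmu := diff _ _ _ _ muW Wx.
  rewrite -dMM //; last exact: Wc.
  rewrite -(dM_cst c x (- 1%:M : 'M[quat R]_1) X'); apply: dM_near; first exact: Wc.
  exact: filterS (nW x Wx).
have dw x X' : W x -> dM c w x X' = b0 b *m dM c (fun x => dM c g x ux) x X' +
    (b0 b *m dM c g x X' *m z x + gsec b (g x) *m dM c z x X').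
  move=> Wx; have cx := Wc x Wx.
  have dpsi := diff _ _ _ _ psiW Wx; have dz := diff _ _ _ _ zW Wx.
  have dg := diff _ _ _ _ gW Wx; have ddg := diff _ _ _ _ (dgW ux) Wx.
  have sx := diffR_subalgebra c x.
  have -> : dM c w x X' = dM c (fun x => b0 b *m dM c g x ux + gsec b (g x) *m z x) x X'.
    by apply: dM_near => //; exact: filterS (nW x Wx).
  rewrite dMD; [|by apply: (mwiseM sx); [exact: (mwise_cst sx)|exact: ddg]|exact: (mwiseM sx dpsi dz)].
  by rewrite (dM_cstM _ _ cx ddg) (dMM _ cx dpsi dz) (dM_gsec b X' cx dg).
have dwS x X' : W x -> dM c S x X' *m w x + S x *m dM c w x X' =
    - (dM c w x X' *m gmu c g x + w x *m dM c (gmu c g) x X').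
  move=> Wx; have cx := Wc x Wx.
  have dmu := diff _ _ _ _ muW Wx; have dw' := diff _ _ _ _ wW Wx.
  have dS := diff _ _ _ _ SW Wx; have sx := diffR_subalgebra c x.
  rewrite -(dMM X' cx dS dw') -(dMM X' cx dw' dmu) -dMN; last exact: (mwiseM sx dw' dmu).
  by apply: dM_near => //; exact: filterS (nW x Wx).
have Qw x : W x -> S x *m dM c S x ux *m w x = dM c S x uy *m w x.
  by move=> Wx; apply/hopfQ_eq0; apply: (mcs_Q HS) => //; [exact: Wc|exact: Lw].
have g12 x : W x -> dM c (fun x => dM c g x ux) x uy =
    dM c (fun x => dM c g x ux) x ux *m gmu c g x +
    dM c g x ux *m dM c (gmu c g) x ux.
  move=> Wx; have cx := Wc x Wx.
  rewrite (dM_comm ux uy oW gW Wx cx).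
  rewrite -(dMM ux cx (diff _ _ _ _ (dgW ux) Wx) (diff _ _ _ _ muW Wx)).
  by apply: dM_near => //; exact: filterS (nW x Wx).
have beta x : W x -> gbeta c g x = z x *m gmu c g x - gmu c g x *m z x.
  move=> Wx; apply: (@backlund_beta R (gsec b (g x)) (b0 b) (gann b (g x))
    (gann_gsec _ _) (gann_b0 _ _) (dM c g x ux) _ _ _ _ (dM c z x ux) (dM c z x uy)
    (dM c (fun x => dM c g x ux) x ux) (S x) (dM c S x ux) (dM c S x uy) (g1n0 x Wx)
    (mumu x Wx) (am x ux Wx) (rSpsi x Wx) (rSb x Wx) (SS x)
    (w x) (dM c w x ux) (dM c w x uy) (wE x Wx) _ _ (Sw x Wx) (dwS x ux Wx)
    (dwS x uy Wx) (Qw x Wx)).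
    by rewrite dw // addrA.
  by rewrite dw // g12 // addrA g2E.
have HStV := mcs_on_sub oV (@subsetT _ V) HSt.
have Tfacts x (Wx : W x) := mcs_formula imm HStV G ac (Wc x Wx) (WV x Wx).
have Tw x : W x -> St x *m w x = w x *m gmu c g x.
  move=> Wx; have [_ Tpsi Tb _] := Tfacts x Wx.
  rewrite wE //; apply: (sphere_on_transverse Tpsi Tb); [exact: g2E|exact: beta].
have dwT x X' : W x -> dM c St x X' *m w x + St x *m dM c w x X' =
    dM c w x X' *m gmu c g x + w x *m dM c (gmu c g) x X'.
  move=> Wx; have cx := Wc x Wx.
  have dmu := diff _ _ _ _ muW Wx; have dw' := diff _ _ _ _ wW Wx.
  have dT := diff _ _ _ _ StW Wx.
  rewrite -(dMM X' cx dT dw') -(dMM X' cx dw' dmu).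
  by apply: dM_near => //; exact: filterS (nW x Wx).
have S1w := Lspan q _ Wq (mcs_dS HS ux ac cq I (Lw q Wq)).
have w2L : L q (dM c w q uy - S q *m dM c w q ux).
  have [_ Lconf] := mcs_conf HS ux ac cq I V1q (gauge_section G1).
  have dphi := diff _ _ _ _ phiW Wq; have ds := diff _ _ _ _ sW Wq.
  rewrite wdef !(dMM _ cq dphi ds).
  have conclude (p1 p2 p : 'cV[quat R]_2) (T : 'M[quat R]_2) (t t1 t2 : 'M[quat R]_1) :
      L q p -> L q (T *m p) -> L q (T *m p1 - p2) ->
      L q (p2 *m t + p *m t2 - T *m (p1 *m t + p *m t1)).
    move=> Lp LTp Ld.
    have -> : p2 *m t + p *m t2 - T *m (p1 *m t + p *m t1) =
        p *m t2 - (T *m p *m t1 + (T *m p1 - p2) *m t).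
      rewrite mulmxDr mulmxBl !mulmxA.
      move: (p2 *m t) (p *m t2) (T *m p1 *m t) (T *m p *m t1) => x1 x2 x3 x4.
      by mx_zmod.
    by apply: fiberB; [|apply: fiberD]; exact: fiberM.
  apply: conclude Lconf; first exact: Lphi.
  by apply: (mcs_stab HS I); exact: Lphi.
have w2E := Lspan q _ Wq w2L.
have w2E' : dM c w q uy = S q *m dM c w q ux + w q *m (inv1 (dM c g q ux) *m
    (gann b (g q) *m (dM c w q uy - S q *m dM c w q ux))).
  by rewrite -w2E addrC subrK.
have Aw := hopf_fields_agree (SS q) (TT q) (Sw q Wq) (Tw q Wq) (dwS q ux Wq) (dwS q uy Wq)
  (dwT q ux Wq) (dwT q uy Wq) S1w w2E'.
have [_ Tpsi Tb _] := Tfacts q Wq.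
have Lpsi : Lt q (gsec b (g q)) := gauge_gsec G Vq.
have Apsi := (ker_hopfA Ss HS ker (gsec b (g q)) ac cq Uq).1 Lpsi.
have eqE1 : hopfQ St c q ux = hopfA S c q ux.
  apply: (eq_on_frame (g1n0 q Wq) (wE q Wq)).
    by rewrite (mcs_Q HSt ux ac cq I Lpsi) Apsi.
  by rewrite hopfQE hopfAE !rsc_mulmx Aw.
have dS := diff _ _ _ _ SW Wq; have dT := diff _ _ _ _ StW Wq.
(* S + St maps into Lt = ker A, so that A S = - A St; this passes from X to JX. *)
have AST : hopfA S c q ux *m (S q + St q) = 0.
  have r0 : gann b (g q) *m (S q + St q) = 0.
    apply: (eq_on_frame (g1n0 q Wq) (wE q Wq)); rewrite mul0mx -mulmxA (mulmxDl (S q)).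
      by rewrite Tpsi mulmxDr (rSpsi q Wq) gann_gsecM addr0.
    by rewrite Sw // Tw // addNr mulmx0.
  rewrite [S q + St q](gauge_dec b (g q)) r0 mulmx0 addr0 mulmxA Apsi mul0mx.
  by [].
rewrite (hopfA_dec SS dS) (hopfQ_dec TT dT) eqE1; congr (_ + _).
have AS : hopfA S c q ux *m S q = - (hopfA S c q ux *m St q).
  by apply/eqP; rewrite -addr_eq0 -mulmxDr AST.
rewrite (hopfA_anti cq SS dS) AS opprK -[in LHS]eqE1 -[in RHS]eqE1 (hopfQ_anti cq TT dT).
by rewrite rscN opprK.
Qed.
End AtPoint.
End Transform.

(** * The two-step Baecklund transform *)

Section Conclusion.
Variables (R : realType) (M : riemannSurface R).
Variables (L Lt : lineSubbundle M) (S : M -> 'M[quat R]_2) (U : set M).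
Hypotheses (Ss : smooth setT S) (HS : mcs_on L setT S).
Hypothesis Wil : closed_form1 (star (hopfA S)).
Hypotheses (oU : open U) (dU : dense U) (ker : forall p, U p -> Lt p = kerA S p).
Hypothesis imm : immersed Lt.

Lemma one11_neq0 : (1%:M : 'M[quat R]_1) <> 0.
Proof.
move=> /matrixP/(_ 0 0); rewrite !mxE => /eqP.
by rewrite (negbTE (oner_neq0 _)).
Qed.

(** If L = Lt on an open set, psi is a section of L, so psi_2 = S psi_1 modulo
    the line; with [backlund_conf] this gives g_2 = 0, against mu^2 = -1. *)
Lemma backlund_line_differs (O : set M) : O !=set0 -> open O ->
  exists q, [/\ O q, U q & exists u, L q u /\ ~ Lt q u].
Proof.
move=> O0 oO; have [q [Oq Uq]] := dU O0 oO.
apply: contrapT => H.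
have LLt x u : O x -> U x -> L x u -> Lt x u.
  move=> Ox Ux Lu; apply: contrapT => nL; apply: H; exists x; split=> //.
  by exists u.
have [c [ac cq]] := exists_chart q.
have [V [b [g [Vq G]]]] := gauge_exists Lt q; have [oV gs Lg] := G.
pose W := (V `&` O) `&` U.
have oW : open W by apply: openI => //; exact: openI.
have Lpsi x : W x -> L x (gsec b (g x)).
  move=> [[Vx Ox] Ux].
  have [V' [b' [h [V'x G']]]] := gauge_exists L x.
  have Lphi := gauge_gsec G' V'x.
  have phiE := gauge_fiberE G Vx (LLt x _ Ox Ux Lphi).
  set phi := gsec b' (h x) in Lphi phiE; set a := e1 b *m phi in phiE.
  have a0 : a <> 0.
    move=> a0; apply: one11_neq0; rewrite -(e1_gsec b' (h x)) -/phi phiE a0.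
    by rewrite !mulmx0.
  have -> : gsec b (g x) = phi *m inv1 a by rewrite phiE -mulmxA mulm1V ?mulmx1.
  exact: fiberM.
have sec : local_section L W (fun x => gsec b (g x)).
  split=> //; apply: smooth_sub (smooth_gsec b oV gs) => x [[]] //.
have Wq : W q by split.
have [_ Lc] := mcs_conf HS ux ac cq I Wq sec.
have dg := gauge_diff G ac cq Vq.
have gS : gann b (g q) *m (S q *m (b0 b *m dM c g q ux) - b0 b *m dM c g q uy) = 0.
  apply: (Lg q Vq _).1; apply: LLt => //.
  by rewrite -!(dM_gsec b _ cq dg).
move: gS; rewrite mulmxBr gann_b0M (backlund_conf Ss HS Wil oU dU ker ac G Vq cq).
rewrite -opprD => /eqP; rewrite oppr_eq0 => /eqP /(congr1 (rsc 2^-1)).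
rewrite half_double rsc0 => g2.
have := backlund_mu Ss HS Wil oU dU ker imm ac G Vq cq.
rewrite /gmu g2 !mulmx0 => /eqP; rewrite eq_sym oppr_eq0 => /eqP.
exact: one11_neq0.
Qed.

Lemma backlund_Q St : mean_curvature_sphere Lt St ->
  eq_form1 (hopfQ St) (hopfA S).
Proof.
move=> /mcs_onP[Sts HSt] c p X ac cp; apply/subr0_eq.
have oc := @cdom_open _ _ c; have sa := @smoothR_in_subalgebra _ _ c _ oc.
have sub := @subsetT _ (cdom c).
apply: (@dense_eq0 _ _ [set q | U q /\ exists u, L q u /\ ~ Lt q u] c (cdom c) _ _
  (fun q => hopfQ St c q X - hopfA S c q X)) => //.
- move=> O O0 oO; have [q [Oq Uq Lq]] := backlund_line_differs O0 oO.
  by exists q.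
- apply: (mwiseB sa); apply: smooth_in_sub sub _.
    by apply: smooth_hopfQ; exact: (smoothP _ _).1.
  by apply: smooth_hopfA; exact: (smoothP _ _).1.
- move=> q [Uq [u [Lu nLu]]] cq.
  by rewrite (hopfQ_backlund_at Ss HS Wil oU dU ker imm Sts HSt ac cq Uq Lu nLu) subrr.
Qed.

(** St itself restricts to the complex structure of the line bundle Lt.  The
    Willmore equation is inherited from S, since A(St) - Q(St) is half of the
    derivative of St along J, whose star is closed. *)
Lemma backlund_willmore : willmore Lt.
Proof.
have [St Hm] := backlund_mcs Ss HS Wil oU dU ker imm.
have QA := backlund_Q Hm.
have [Sts HSt] := (mcs_onP Lt St).1 Hm.
split=> //; last exists St.
  exists (fun p u => St p *m u); split.
  - split.
    + by move=> p u; exact: (mcs_stab HSt).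
    + by move=> p u v _ _; rewrite mulmxDr.
    + by move=> p u a _; rewrite /rscale mulmxA.
    + move=> V psi [oV psis _]; apply: smoothM => //.
      exact: smooth_sub (@subsetT _ V) Sts.
  - by move=> p u _; exact: (mcs_sqK u HSt).
  - move=> c p X V psi ac cp Vp Lpsi; apply/proj_eq.
    by have [] := mcs_conf HSt X ac cp I Vp Lpsi.
split; first exact: Hm.
move=> c p X Y ac cp; rewrite /d_form1.
have sa := diffR_subalgebra c p.
have Sc : smooth_in c setT S := (smoothP _ _).1 Ss c ac.
have Stc : smooth_in c setT St := (smoothP _ _).1 Sts c ac.
have dSt Z : mdiff c p (fun q => dM c St q Z).
  exact: (smooth_in_diff (smooth_in_dM Z openT Stc) I cp).
have E Z Z' : dM c (fun q => star (hopfA St) c q Z) p Z' =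
    dM c (fun q => star (hopfA S) c q Z) p Z' -
    (realq 2^-1)%:M *m dM c (fun q => dM c St q Z) p Z'.
  have dA : mdiff c p (fun q => star (hopfA S) c q Z).
    exact: (smooth_in_diff (smooth_hopfA (rot Z) Sc) I cp).
  rewrite -(dM_cstM _ _ cp (dSt Z)) -dMB //.
    apply: dM_near => //; apply: filterS (near_cdom cp) => q cq.
    rewrite /star (hopfA_hopfQ St) (QA c q (rot Z) ac cq) rot_rot.
    rewrite dM_opp; last exact: (smooth_in_diff Stc I cq).
    by rewrite rscN rscE mul_scalar_mx.
  by apply: (mwiseM sa); [exact: (mwise_cst sa)|exact: dSt].
have conclude (P Q P' Q' z z' : 'M[quat R]_2) :
    P = P' - z -> Q = Q' - z' -> z = z' -> P' - Q' = 0 -> P - Q = 0.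
  by move=> -> -> -> /subr0_eq ->; rewrite subrr.
exact: (conclude _ _ _ _ _ _ (E Y X) (E X Y)
  (congr1 (mulmx _) (dM_comm Y X openT Stc I cp)) (Wil X Y ac cp)).
Qed.

End Conclusion.

Theorem theorem7 (R : realType) (M : riemannSurface R)
    (L : lineSubbundle M) (S : M -> 'M[quat R]_2)
    (hL : willmore L)
    (hS : mean_curvature_sphere L S)
    (hA : hopfA_nonzero_on_components S)
    (Lt : lineSubbundle M)
    (hLt : two_step_backlund S Lt)
    (hLt_imm : immersed Lt) :
  (forall St : M -> 'M[quat R]_2,
     mean_curvature_sphere Lt St -> eq_form1 (hopfQ St) (hopfA S)) /\
  willmore Lt.
Proof.
have [imm _ [S' [hS' closed]]] := hL.
have [Ss HS] := (mcs_onP L S).1 hS; have [_ HS'] := (mcs_onP L S').1 hS'.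
have SS' : S' = S.
  apply/funext => q; have [c [ac cq]] := exists_chart q.
  have [V [b [g [Vq G]]]] := gauge_exists L q; have [oV _ _] := G.
  have [-> _ _ _] := mcs_formula imm (mcs_on_sub oV (@subsetT _ V) HS) G ac cq Vq.
  by have [-> _ _ _] := mcs_formula imm (mcs_on_sub oV (@subsetT _ V) HS') G ac cq Vq.
rewrite SS' in closed; have [U [oU dU ker]] := hLt.
split; first by move=> St; exact: (backlund_Q Ss HS closed oU dU ker hLt_imm).
exact: (backlund_willmore Ss HS closed oU dU ker hLt_imm).
Qed.
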